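(* Let $M$ be a smooth plane curve and let $k\ge 3$ be an integer. Suppose a circle has $A_k$ contact with $M$ at a point $\gamma(s_0)$. If $k$ is odd, then in a neighbourhood of the diagonal point $(s_0,s_0)$ the pre-symmetry set of $M$ consists of a single smooth branch through $(s_0,s_0)$ which is transverse to the diagonal $\{s=t\}$. If $k$ is even, then $(s_0,s_0)$ is an isolated point of the pre-symmetry set.
   Context: $\gamma$ is a smooth regular parametrization of the plane curve $M$, and $\mathbf{T}$ denotes its unit tangent vector. A circle with centre $c$ and radius $r>0$ (so lines are excluded) has $A_k$ contact with $M$ at $\gamma(s_0)$ if the function $s\mapsto |\gamma(s)-c|^2-r^2$ vanishes at $s_0$ together with its derivatives up to order exactly $k$ (the $(k+1)$-st derivative is nonzero). The case $k\geq 3$ means that $\gamma(s_0)$ is a vertex or a more degenerate critical point of the curvature, the circle being the circle of curvature there, with nonzero curvature. The pre-symmetry set consists of pairs $(s,t)$ for which there is a circle tangent to $M$ at $\gamma(s)$ and at $\gamma(t)$. Near a diagonal point it is described as follows. Let $g(s,t)=(\gamma(s)-\gamma(t))\cdot(\mathbf{T}(s)-\mathbf{T}(t))$. The function $g$ is divisible by $(s-t)^4$, say $g(s,t)=(s-t)^4\,\tilde g(s,t)$ with $\tilde g$ smooth, and near the diagonal point the pre-symmetry set (with the spurious diagonal component removed) is understood to be the zero set $\{\tilde g=0\}$. *)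

(* Defs.v *)
From Stdlib Require Import Reals.
From Coquelicot Require Import Coquelicot.
Open Scope R_scope.

(* The norm on [R * R] used below is Coquelicot's product norm, which is the
   Euclidean one: [norm u = sqrt (norm (fst u) ^ 2 + norm (snd u) ^ 2)]. *)

Definition dot (u v : R * R) : R := fst u * fst v + snd u * snd v.

(* Extended end points: every open interval of the line is of this form. *)
Definition in_itv (a b : Rbar) (x : R) : Prop := Rbar_lt a x /\ Rbar_lt x b.

(* [ex_derive_n] at every order on an open set is C^infinity there. *)
Definition smooth_on (a b : Rbar) (f : R -> R) : Prop :=
  forall (n : nat) (x : R), in_itv a b x -> ex_derive_n f n x.

(* [ex_diff_n f n x y] asks that all the iterated partial derivatives of
   order at most [n], in any order of differentiation, exist and be continuous
   at [(x, y)]; on an open square and for every [n] this is C^infinity. *)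
Definition smooth2_on (a b : Rbar) (f : R -> R -> R) : Prop :=
  forall (n : nat) (x y : R), in_itv a b x -> in_itv a b y -> ex_diff_n f n x y.

Definition velocity (gamma : R -> R * R) (s : R) : R * R :=
  (Derive (fun u => fst (gamma u)) s, Derive (fun u => snd (gamma u)) s).

Definition smooth_regular (a b : Rbar) (gamma : R -> R * R) : Prop :=
  smooth_on a b (fun u => fst (gamma u)) /\
  smooth_on a b (fun u => snd (gamma u)) /\
  forall s : R, in_itv a b s -> velocity gamma s <> (0, 0).

Definition unit_tangent (gamma : R -> R * R) (s : R) : R * R :=
  scal (/ norm (velocity gamma s)) (velocity gamma s).

Definition circle_contact (gamma : R -> R * R) (c : R * R) (r : R) (s : R) : R :=
  norm (minus (gamma s) c) ^ 2 - r ^ 2.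

(* The order-0 derivative is the function itself. *)
Definition has_A_contact (gamma : R -> R * R) (c : R * R) (r : R)
    (k : nat) (s0 : R) : Prop :=
  0 < r /\
  (forall i : nat, (i <= k)%nat -> Derive_n (circle_contact gamma c r) i s0 = 0) /\
  Derive_n (circle_contact gamma c r) (S k) s0 <> 0.

Definition presym_fun (gamma : R -> R * R) (s t : R) : R :=
  dot (minus (gamma s) (gamma t))
      (minus (unit_tangent gamma s) (unit_tangent gamma t)).

(* [gt] is the smooth quotient of [presym_fun gamma] by [(s - t)^4]; on the
   diagonal its values are determined by continuity. *)
Definition presym_quotient (a b : Rbar) (gamma : R -> R * R)
    (gt : R -> R -> R) : Prop :=
  smooth2_on a b gt /\
  forall s t : R, in_itv a b s -> in_itv a b t ->
    presym_fun gamma s t = (s - t) ^ 4 * gt s t.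

Definition presym_set (a b : Rbar) (gt : R -> R -> R) (p : R * R) : Prop :=
  in_itv a b (fst p) /\ in_itv a b (snd p) /\ gt (fst p) (snd p) = 0.

Definition arc_image (e : R) (beta : R -> R * R) (p : R * R) : Prop :=
  exists x : R, - e < x < e /\ beta x = p.

(* A smooth immersion of ]-e, e[ that is a homeomorphism onto its image: the
   inverse [rho] is continuous for the topology induced by the plane, which
   excludes self-crossings and ends accumulating on the arc. *)
Definition embedded_arc (e : R) (beta : R -> R * R) : Prop :=
  smooth_regular (- e) e beta /\
  exists rho : R * R -> R, forall x : R, - e < x < e ->
    rho (beta x) = x /\
    filterlim rho (within (arc_image e beta) (locally (beta x))) (locally x).

(* The diagonal has direction (1, 1), so a branch is transverse to it when,
   wherever they meet, its two velocity components differ. *)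
Definition transverse_to_diagonal (e : R) (beta : R -> R * R) : Prop :=
  forall x : R, - e < x < e -> fst (beta x) = snd (beta x) ->
    fst (velocity beta x) <> snd (velocity beta x).

Definition single_transverse_branch (Z : R * R -> Prop) (p : R * R) : Prop :=
  exists (U : R * R -> Prop) (e : R) (beta : R -> R * R),
    open U /\ U p /\ 0 < e /\
    embedded_arc e beta /\ beta 0 = p /\
    (forall q : R * R, U q /\ Z q <-> arc_image e beta q) /\
    transverse_to_diagonal e beta.

Definition isolated_point (Z : R * R -> Prop) (p : R * R) : Prop :=
  Z p /\
  exists U : R * R -> Prop,
    open U /\ U p /\ forall q : R * R, U q -> Z q -> q = p.

(* Main.v *)
Require Import Defs.
From Stdlib Require Import Reals Ranalysis5 Arith Lra Lia Psatz.
From Coquelicot Require Import Coquelicot.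
Open Scope R_scope.

(** The proof describes the curve by the support function of its tangent lines
    instead of by its points. Put the origin at the centre of the given circle and
    the first axis along the tangent at [s0], and let [u] be the tangent of half
    the angle by which the tangent has turned. Contact of order at least two with
    a circle forces a nonzero curvature, so [u] is a local parameter. If [h] is the
    support function, that is, the coordinate of the curve along its unit normal,
    and [rho = h(s0)], set [J = (1 + u^2) (h - rho)]. For a circle this function is
    a quadratic polynomial in [u], and every quadratic polynomial arises from an
    oriented circle, possibly of radius zero; tangency at the parameter [a] means agreement of value and
    slope at [a].

    Hence there is a circle tangent at the parameters [a] and [b] exactly when
    some quadratic polynomial interpolates the values and slopes of [J] there, i.e.
    when the trapezoid rule for [J'] is exact:
    [2 (J a - J b) = (a - b) (J' a + J' b)]. Indeed [presym_fun] is [u s - u t] times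
    the defect in this equation times a positive factor ([laguerre_chart]).
    Moreover, contact of type A_k makes [J] vanish at [0] to order exactly [k + 1].

    By Rolle's theorem the defect of [J] at [a <> b] can vanish only if [J''] takes
    the same value twice ([trapezoid_zero]). For even [k] the function [J'''] has
    even order at [0], so [J''] is injective near [0] and no point off the diagonal
    is left ([trapezoid_isolated]). For odd [k] the same argument is applied to [J']:
    its defect is the derivative in [x] of the defect of [J] at [(x + d, x - d)], so
    for each [d <> 0] there is at most one zero [x]. The zero is found by the
    blow-up [x = d q]: writing [J = x^(k+1) chi], the defect equals
    [d^(k+1) H (q, d)], where [H] is smooth with a simple zero in [q] at the origin,
    and the implicit function theorem provides a smooth [q] ([trapezoid_branch]).
    On the diagonal, the error term of the trapezoid rule shows that the quotient
    by [(s - t)^4] is a nonzero multiple of [J''' (u s)] ([diagonal_value]), which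
    vanishes only at [s0]. *)

(** * Smooth functions on a normed module *)

(** Differentiability is Fréchet differentiability, and the derivative is fed
    back into the recursion one direction at a time: this keeps every level
    real-valued, and the line and the plane are treated at once. *)
Fixpoint Ck {V : NormedModule R_AbsRing} (n : nat) (D : V -> Prop)
    (f : V -> R) : Prop :=
  match n with
  | O => forall x, D x -> continuous f x
  | S m => exists df : V -> V -> R,
      (forall x, D x -> filterdiff f (locally x) (df x)) /\
      forall v, Ck m D (fun x => df x v)
  end.

Definition smooth {V : NormedModule R_AbsRing} (D : V -> Prop) (f : V -> R) :=
  forall n, Ck n D f.

Section Closure.
Context {V : NormedModule R_AbsRing}.
Implicit Types (D : V -> Prop) (f g : V -> R).

Lemma Ck_pred n D f : Ck (S n) D f -> Ck n D f.
Proof.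
  revert f; induction n as [|n IH]; intros f (df & Hf & Hdf).
  - intros x Dx. apply (filterdiff_continuous (V := R_NormedModule) f). exists (df x); now apply Hf.
  - exists df; split; [easy|]. intros v. now apply IH.
Qed.

Lemma Ck_subset n D D' f : (forall x, D' x -> D x) -> Ck n D f -> Ck n D' f.
Proof.
  intros HD; revert f; induction n as [|n IH]; intros f.
  - intros H x Dx; now apply H, HD.
  - intros (df & Hf & Hdf). exists df; split.
    + intros x Dx; now apply Hf, HD.
    + intros v; now apply IH.
Qed.

Lemma Ck_ext n D f g :
  open D -> (forall x, D x -> f x = g x) -> Ck n D f -> Ck n D g.
Proof.
  intros OD E; destruct n as [|n].
  - intros H x Dx. apply continuous_ext_loc with f; [|now apply H].
    now apply filter_imp with (2 := OD x Dx).
  - intros (df & Hf & Hdf). exists df; split; [|easy].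
    intros x Dx.
    apply filterdiff_ext_loc with f; [now apply filter_imp with (2 := OD x Dx)| |now apply Hf].
    intros y Hy. rewrite <- (is_filter_lim_locally_unique x y Hy). now apply E.
Qed.

Lemma Ck_const n D (c : R) : Ck n D (fun _ => c).
Proof.
  revert c; induction n as [|n IH]; intros c.
  - intros x _. apply continuous_const.
  - exists (fun _ _ => 0); split; [intros x _; apply (filterdiff_const (V := R_NormedModule))|].
    intros _; apply IH.
Qed.

Lemma Ck_linear n D f : is_linear (V := R_NormedModule) f -> Ck n D f.
Proof.
  intros L. destruct n as [|n].
  - intros x _. apply (filterdiff_continuous (V := R_NormedModule) f). exists f. now apply filterdiff_linear.
  - exists (fun _ => f); split.
    + intros x _. now apply filterdiff_linear.
    + intros v. apply Ck_const.
Qed.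

Lemma Ck_plus n D f g : Ck n D f -> Ck n D g -> Ck n D (fun x => f x + g x).
Proof.
  revert f g; induction n as [|n IH]; intros f g.
  - intros Hf Hg x Dx. apply (continuous_plus f g); auto.
  - intros (df & Hf & Hdf) (dg & Hg & Hdg).
    exists (fun x v => df x v + dg x v); split.
    + intros x Dx. apply (filterdiff_plus_fct f g); auto.
    + intros v. apply (IH (fun x => df x v) (fun x => dg x v)); auto.
Qed.

Lemma Ck_mult n D f g : Ck n D f -> Ck n D g -> Ck n D (fun x => f x * g x).
Proof.
  revert f g; induction n as [|n IH]; intros f g.
  - intros Hf Hg x Dx. apply (continuous_mult f g); auto.
  - intros Cf Cg. generalize (Ck_pred _ _ _ Cf) (Ck_pred _ _ _ Cg).
    destruct Cf as (df & Hf & Hdf), Cg as (dg & Hg & Hdg). intros Cf Cg.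
    exists (fun x v => df x v * g x + f x * dg x v); split.
    + intros x Dx. apply (filterdiff_mult_fct f g); auto. apply Rmult_comm.
    + intros v. apply (Ck_plus n D (fun x => df x v * g x) (fun x => f x * dg x v)).
      * now apply (IH (fun x => df x v)).
      * now apply (IH f (fun x => dg x v)).
Qed.

Lemma Ck_comp n D (D' : R -> Prop) (g : R -> R) f :
  (forall x, D x -> D' (f x)) ->
  Ck (V := R_NormedModule) n D' g -> Ck n D f -> Ck n D (fun x => g (f x)).
Proof.
  intros HD; revert g; induction n as [|n IH]; intros g.
  - intros Hg Hf x Dx. apply (continuous_comp f g); auto.
  - intros (dg & Hg & Hdg) Cf. generalize (Ck_pred _ _ _ Cf).
    destruct Cf as (df & Hf & Hdf). intros Cf.
    exists (fun x v => df x v * dg (f x) 1); split.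
    + intros x Dx.
      eapply filterdiff_ext_lin.
      * apply (filterdiff_comp' f g); [now apply Hf|now apply Hg, HD].
      * intros v. simpl.
        replace (df x v) with (scal (df x v) 1 : R) at 1 by apply Rmult_1_r.
        rewrite (linear_scal _ (proj1 (Hg _ (HD x Dx)))). reflexivity.
    + intros v. apply (Ck_mult n D (fun x => df x v)); [easy|].
      apply (IH (fun y => dg y 1)); auto.
Qed.

(** Linearity of the differential of [g] splits it into its two partial
    derivatives, to which the induction hypothesis applies. *)
Lemma Ck_comp2 n D (D' : R * R -> Prop) (g : R * R -> R) f1 f2 :
  (forall x, D x -> D' (f1 x, f2 x)) ->
  Ck (V := prod_NormedModule _ R_NormedModule R_NormedModule) n D' g ->
  Ck n D f1 -> Ck n D f2 -> Ck n D (fun x => g (f1 x, f2 x)).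
Proof.
  intros HD; revert g; induction n as [|n IH]; intros g.
  - intros Hg Hf1 Hf2 x Dx.
    apply (continuous_comp_2 f1 f2 (fun a b => g (a, b))); auto.
    apply continuous_ext with g; [now intros []|auto].
  - intros (dg & Hg & Hdg) Cf1 Cf2.
    generalize (Ck_pred _ _ _ Cf1) (Ck_pred _ _ _ Cf2).
    destruct Cf1 as (df1 & Hf1 & Hdf1), Cf2 as (df2 & Hf2 & Hdf2). intros Cf1 Cf2.
    exists (fun x v => df1 x v * dg (f1 x, f2 x) (1, 0) + df2 x v * dg (f1 x, f2 x) (0, 1)).
    split.
    + intros x Dx.
      eapply filterdiff_ext_lin.
      * apply (filterdiff_comp'_2 f1 f2 (fun a b => g (a, b)) x (df1 x) (df2 x)
                 (fun a b => dg (f1 x, f2 x) (a, b))); [now apply Hf1|now apply Hf2|].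
        apply (filterdiff_ext g); [now intros []|].
        eapply filterdiff_ext_lin; [now apply Hg, HD|now intros []].
      * intros v. simpl.
        pose proof (proj1 (Hg _ (HD x Dx))) as L.
        transitivity (dg (f1 x, f2 x) (plus (scal (df1 x v) (1, 0)) (scal (df2 x v) (0, 1)))).
        -- f_equal. unfold plus, scal; simpl.
           unfold prod_plus, prod_scal, plus, scal; simpl.
           unfold mult; simpl. f_equal; ring.
        -- rewrite (linear_plus _ L), !(linear_scal _ L). reflexivity.
    + intros v. apply (Ck_plus n D (fun x => df1 x v * dg (f1 x, f2 x) (1, 0))
                                   (fun x => df2 x v * dg (f1 x, f2 x) (0, 1))).
      * apply (Ck_mult n D (fun x => df1 x v)); [easy|].
        now apply (IH (fun z => dg z (1, 0))).
      * apply (Ck_mult n D (fun x => df2 x v)); [easy|].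
        now apply (IH (fun z => dg z (0, 1))).
Qed.

Lemma smooth_subset D D' f : (forall x, D' x -> D x) -> smooth D f -> smooth D' f.
Proof. intros H Hf n; now apply Ck_subset with D. Qed.

Lemma smooth_ext D f g :
  open D -> (forall x, D x -> f x = g x) -> smooth D f -> smooth D g.
Proof. intros OD E Hf n; now apply Ck_ext with f. Qed.

Lemma smooth_const D (c : R) : smooth D (fun _ => c).
Proof. intros n; apply Ck_const. Qed.

Lemma smooth_linear D f : is_linear (V := R_NormedModule) f -> smooth D f.
Proof. intros L n; now apply Ck_linear. Qed.

Lemma smooth_plus D f g : smooth D f -> smooth D g -> smooth D (fun x => f x + g x).
Proof. intros Hf Hg n; now apply Ck_plus. Qed.

Lemma smooth_mult D f g : smooth D f -> smooth D g -> smooth D (fun x => f x * g x).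
Proof. intros Hf Hg n; now apply Ck_mult. Qed.

Lemma smooth_pow D f m : smooth D f -> smooth D (fun x => f x ^ m).
Proof.
  intros Hf; induction m as [|m IH]; simpl.
  - apply smooth_const.
  - now apply smooth_mult.
Qed.

Lemma smooth_comp D (D' : R -> Prop) (g : R -> R) f :
  (forall x, D x -> D' (f x)) ->
  smooth (V := R_NormedModule) D' g -> smooth D f -> smooth D (fun x => g (f x)).
Proof. intros HD Hg Hf n; now apply Ck_comp with D'. Qed.

Lemma smooth_continuous D f x : smooth D f -> D x -> continuous f x.
Proof. intros Hf Dx; exact (Hf O x Dx). Qed.

End Closure.

Lemma smooth_opp {V : NormedModule R_AbsRing} (D : V -> Prop) f :
  smooth D f -> smooth D (fun x => - f x).
Proof.
  intros Hf n. apply (Ck_comp n D (fun _ => True) Ropp f); [easy| |easy].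
  apply (Ck_linear (V := R_NormedModule)), ((is_linear_opp (V := R_NormedModule))).
Qed.

Lemma smooth_minus {V : NormedModule R_AbsRing} (D : V -> Prop) f g :
  smooth D f -> smooth D g -> smooth D (fun x => f x - g x).
Proof. intros Hf Hg. apply smooth_plus; [easy|]. now apply smooth_opp. Qed.

(** * Smooth functions of one variable *)

Implicit Types D : R -> Prop.

Notation Ck1 := (Ck (V := R_NormedModule)).
Notation smooth1 := (smooth (V := R_NormedModule)).

Lemma Ck1_S n D (f df : R -> R) :
  (forall x, D x -> is_derive f x (df x)) -> Ck1 n D df -> Ck1 (S n) D f.
Proof.
  intros Hf Hdf. exists (fun x v => scal v (df x)); split; [exact Hf|].
  intros v. apply (Ck_mult (V := R_NormedModule)); [apply Ck_const|exact Hdf].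
Qed.

Lemma Ck1_derive n D (f : R -> R) : open D -> Ck1 (S n) D f ->
  (forall x, D x -> is_derive f x (Derive f x)) /\ Ck1 n D (Derive f).
Proof.
  intros OD (df & Hf & Hdf).
  assert (H : forall x, D x -> is_derive f x (df x 1)).
  { intros x Dx. unfold is_derive. eapply filterdiff_ext_lin; [now apply Hf|].
    intros y. rewrite <- (linear_scal _ (proj1 (Hf x Dx))).
    f_equal. symmetry; apply Rmult_1_r. }
  split.
  - intros x Dx. apply Derive_correct. exists (df x 1). now apply H.
  - apply (Ck_ext (V := R_NormedModule)) with (fun x => df x 1); [easy| |easy].
    intros x Dx. symmetry. now apply is_derive_unique, H.
Qed.

Lemma smooth1_is_derive D f x : open D -> smooth1 D f -> D x -> is_derive f x (Derive f x).
Proof. intros OD Hf. now apply (Ck1_derive 0). Qed.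

Lemma smooth1_Derive D f : open D -> smooth1 D f -> smooth1 D (Derive f).
Proof. intros OD Hf n. now apply (Ck1_derive n). Qed.

Lemma smooth1_Derive_n D f n : open D -> smooth1 D f -> smooth1 D (Derive_n f n).
Proof.
  intros OD Hf; induction n as [|n IH]; [exact Hf|]. now apply smooth1_Derive.
Qed.

Lemma smooth1_id D : smooth1 D (fun x => x).
Proof. intros n. apply (Ck_linear (V := R_NormedModule)), ((is_linear_id (V := R_NormedModule))). Qed.

Lemma open_itv a b : open (in_itv a b).
Proof.
  apply (open_and (T := R_UniformSpace)); [apply open_Rbar_gt|apply open_Rbar_lt].
Qed.

Lemma smooth_on_iff a b f : smooth_on a b f <-> smooth1 (in_itv a b) f.
Proof.
  split; intros H.
  - assert (HD : forall m n, Ck1 m (in_itv a b) (Derive_n f n)).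
    { induction m as [|m IH]; intros n.
      - intros x Dx. apply (ex_derive_continuous (V := R_NormedModule)). exact (H (S n) x Dx).
      - apply Ck1_S with (Derive_n f (S n)); [|apply IH].
        intros x Dx. apply Derive_correct. exact (H (S n) x Dx). }
    intros m. exact (HD m 0%nat).
  - intros [|n] x Dx; [exact I|].
    exists (Derive (Derive_n f n) x).
    apply smooth1_is_derive with (in_itv a b); [apply open_itv| |easy].
    apply smooth1_Derive_n; [apply open_itv|easy].
Qed.

(** The derivative of the inverse is a polynomial in the inverse, so regularity
    is gained one order at a time. *)
Lemma smooth1_Rinv : smooth1 (fun x => x <> 0) Rinv.
Proof.
  intros n; induction n as [|n IH].
  - intros x Hx. now apply continuous_Rinv.
  - apply Ck1_S with (fun x => - 1 * (/ x * / x)).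
    + intros x Hx. auto_derive; [easy|]. now field.
    + apply (Ck_mult (V := R_NormedModule)); [apply Ck_const|].
      now apply (Ck_mult (V := R_NormedModule)).
Qed.

Lemma smooth_inv {V : NormedModule R_AbsRing} (D : V -> Prop) f :
  (forall x, D x -> f x <> 0) -> smooth D f -> smooth D (fun x => / f x).
Proof. intros H Hf. now apply (smooth_comp D _ Rinv f H smooth1_Rinv). Qed.

Lemma smooth_div {V : NormedModule R_AbsRing} (D : V -> Prop) f g :
  (forall x, D x -> g x <> 0) -> smooth D f -> smooth D g -> smooth D (fun x => f x / g x).
Proof. intros H Hf Hg. apply smooth_mult; [easy|]. now apply smooth_inv. Qed.

Lemma smooth1_sqrt : smooth1 (fun x => 0 < x) sqrt.
Proof.
  intros n; induction n as [|n IH].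
  - intros x Hx. apply (ex_derive_continuous (V := R_NormedModule)). auto_derive; lra.
  - apply Ck1_S with (fun x => / 2 * / sqrt x).
    + intros x Hx. auto_derive; [easy|]. field.
      apply Rgt_not_eq. now apply sqrt_lt_R0.
    + apply (Ck_mult (V := R_NormedModule)); [apply Ck_const|].
      apply (Ck_comp (V := R_NormedModule)) with (fun x => x <> 0).
      * intros x Hx. apply Rgt_not_eq. now apply sqrt_lt_R0.
      * apply smooth1_Rinv.
      * exact IH.
Qed.

(** * Division by powers and orders of vanishing *)

Definition starlike (D : R -> Prop) (p : R) : Prop :=
  forall x t, D x -> 0 <= t <= 1 -> D (p + (x - p) * t).

Lemma star_cont p x t : continuity_2d_pt (fun u v => p + (u - p) * v) x t.
Proof.
  apply (continuity_2d_pt_plus (fun _ _ => p)); [apply continuity_2d_pt_const|].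
  apply (continuity_2d_pt_mult (fun u _ => u - p)); [|apply continuity_2d_pt_id2].
  apply (continuity_2d_pt_minus (fun u _ => u) (fun _ _ => p));
    [apply continuity_2d_pt_id1|apply continuity_2d_pt_const].
Qed.

Lemma average_derive D (h : R -> R) p j x :
  open D -> starlike D p ->
  Ck1 1 D h -> D x ->
  is_derive (fun x => RInt (fun t => t ^ j * h (p + (x - p) * t)) 0 1) x
    (RInt (fun t => t ^ S j * Derive h (p + (x - p) * t)) 0 1).
Proof.
  intros OD star Ch Dx.
  destruct (Ck1_derive 0 D h OD Ch) as [Hh Hdh].
  assert (H : forall y t, D (p + (y - p) * t) ->
    is_derive (fun u => t ^ j * h (p + (u - p) * t)) y (t ^ S j * Derive h (p + (y - p) * t))).
  { intros y t Dy. pose proof (Hh _ Dy) as E.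
    auto_derive; [eexists; exact E|]. change (fun x0 => h x0) with h. unfold Rminus; simpl; ring. }
  assert (H01 : forall t, Rmin 0 1 <= t <= Rmax 0 1 -> 0 <= t <= 1).
  { intros t. rewrite Rmin_left, Rmax_right; lra. }
  rewrite (RInt_ext _ (fun t => Derive (fun u => t ^ j * h (p + (u - p) * t)) x)).
  2:{ intros t Ht. symmetry. apply is_derive_unique, H, (star x); [easy|].
      apply H01; lra. }
  apply (is_derive_RInt_param (fun y t => t ^ j * h (p + (y - p) * t))).
  - apply filter_imp with (2 := OD x Dx). intros y Dy t Ht.
    eexists. now apply H, (star y), H01.
  - intros t Ht. apply H01 in Ht.
    apply continuity_2d_pt_ext_loc with (fun u v => v ^ S j * Derive h (p + (u - p) * v)).
    + (* nearby values of t may lie outside [0,1] *)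
      apply locally_2d_locally.
      assert (C : continuity_2d_pt (fun u v => p + (u - p) * v) x t)
        by (apply star_cont).
      apply continuity_2d_pt_filterlim in C.
      apply (filter_imp (fun z => D (p + (fst z - p) * snd z)) _) with (2 := C _ (OD _ (star x t Dx Ht))).
      intros z Dz. symmetry. now apply is_derive_unique, H.
    + apply (continuity_2d_pt_mult (fun u v => v ^ S j)).
      * apply (continuity_1d_2d_pt_comp (fun v => v ^ S j) (fun _ v => v)).
        -- apply derivable_continuous_pt, derivable_pt_pow.
        -- apply continuity_2d_pt_id2.
      * apply (continuity_1d_2d_pt_comp (Derive h) (fun u v => p + (u - p) * v)).
        -- apply continuity_pt_filterlim, Hdh. now apply star.
        -- apply star_cont.
  - apply filter_imp with (2 := OD x Dx). intros y Dy.
    apply (ex_RInt_continuous (V := R_CompleteNormedModule)). intros t Ht. apply H01 in Ht.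
    apply (continuous_mult (fun t => t ^ j)).
    + apply continuity_pt_filterlim, derivable_continuous_pt, derivable_pt_pow.
    + apply (continuous_comp (fun t => p + (y - p) * t) h).
      * apply (ex_derive_continuous (V := R_NormedModule)). auto_derive; easy.
      * apply (ex_derive_continuous (V := R_NormedModule)). eexists. now apply Hh, star.
Qed.

(** The derivative of such an average is an average of the same form, of [h']
    and with [j] increased. One order of regularity is given up so that
    continuity comes from differentiability under the integral sign. *)
Lemma Ck1_average n D (h : R -> R) p j :
  open D -> starlike D p ->
  Ck1 (S n) D h -> Ck1 n D (fun x => RInt (fun t => t ^ j * h (p + (x - p) * t)) 0 1).
Proof.
  intros OD star; revert h j; induction n as [|n IH]; intros h j Ch.
  - intros x Dx. apply (ex_derive_continuous (V := R_NormedModule)). eexists.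
    now apply average_derive with D.
  - apply Ck1_S with (fun x => RInt (fun t => t ^ S j * Derive h (p + (x - p) * t)) 0 1).
    + intros x Dx. apply average_derive with D; try easy.
      revert Ch; clear. intros Ch.
      assert (H : forall m, Ck1 (S m) D h -> Ck1 1 D h).
      { intros m; induction m as [|m IH]; [easy|]. intros C. apply IH.
        now apply (Ck_pred (V := R_NormedModule)). }
      now apply (H (S n)).
    + apply IH. now apply (Ck1_derive (S n)).
Qed.

(** Vanishing of order exactly [n] at [p], as a smooth factorization rather than
    as a list of derivatives: this form is stable under products, changes of
    variable and the blow-up used for the branch. *)
Definition has_order (D : R -> Prop) (p : R) (n : nat) (f : R -> R) : Prop :=
  exists chi, smooth1 D chi /\ chi p <> 0 /\ forall x, D x -> f x = (x - p) ^ n * chi x.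

Lemma order_derive D p n f :
  open D -> has_order D p (S n) f -> has_order D p n (Derive f).
Proof.
  intros OD (chi & Schi & Nchi & E).
  exists (fun x => INR (S n) * chi x + (x - p) * Derive chi x); repeat split.
  - apply (smooth_plus (V := R_NormedModule)); apply (smooth_mult (V := R_NormedModule)).
    + apply smooth_const.
    + easy.
    + apply (smooth_minus (V := R_NormedModule)); [apply smooth1_id|apply smooth_const].
    + now apply smooth1_Derive.
  - replace (p - p) with 0 by ring. rewrite Rmult_0_l, Rplus_0_r.
    apply Rmult_integral_contrapositive_currified; [|easy].
    apply not_0_INR; discriminate.
  - intros x Dx. apply is_derive_unique.
    apply (is_derive_ext_loc (fun y => (y - p) ^ S n * chi y)).
    { apply filter_imp with (2 := OD x Dx). intros y Dy; symmetry; now apply E. }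
    pose proof (smooth1_is_derive D chi x OD Schi Dx) as H.
    eapply (filterdiff_ext_lin (V := R_NormedModule)).
    + apply (is_derive_mult (fun y => (y - p) ^ S n) chi); [|exact H|apply Rmult_comm].
      auto_derive; [easy|reflexivity].
    + intros y. rewrite !S_INR. unfold scal, plus, mult; simpl. unfold mult, Rminus; simpl.
      change (match n with 0%nat => 1 | S _ => INR n + 1 end) with (INR (S n)).
      rewrite S_INR. ring.
Qed.

(** Integrating [f' = (x - p)^n chi] along the segment from [p] to [x] exhibits the
    new cofactor as the average of [t^n chi], nonzero at [p] because the mean of
    [t^n] is positive. *)
Lemma order_primitive D p n f :
  open D -> D p -> starlike D p -> smooth1 D f -> f p = 0 ->
  has_order D p n (Derive f) -> has_order D p (S n) f.
Proof.
  intros OD Dp star Sf f0 (chi & Schi & Nchi & E).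
  exists (fun x => RInt (fun t => t ^ n * chi (p + (x - p) * t)) 0 1); repeat split.
  - intros m. now apply Ck1_average.
  - rewrite (RInt_ext _ (fun t => scal (chi p) (t ^ n))).
    2:{ intros t _. replace (p + (p - p) * t) with p by ring. apply Rmult_comm. }
    rewrite (RInt_scal (V := R_CompleteNormedModule)).
    2:{ apply (ex_RInt_continuous (V := R_CompleteNormedModule)). intros z _.
        apply (ex_derive_continuous (V := R_NormedModule)). auto_derive; easy. }
    apply Rmult_integral_contrapositive_currified; [easy|].
    apply Rgt_not_eq, RInt_gt_0; [lra| |].
    + intros x Hx. apply pow_lt; lra.
    + intros x _. apply (ex_derive_continuous (V := R_NormedModule)). auto_derive; easy.
  - intros x Dx.
    assert (I : is_RInt (fun t => (x - p) * Derive f (p + (x - p) * t)) 0 1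
                        (minus (f (p + (x - p) * 1)) (f (p + (x - p) * 0)))).
    { assert (H01 : forall t, Rmin 0 1 <= t <= Rmax 0 1 -> 0 <= t <= 1).
      { intros t. rewrite Rmin_left, Rmax_right; lra. }
      apply (is_RInt_derive (V := R_CompleteNormedModule) (fun t => f (p + (x - p) * t))).
      - intros t Ht. apply H01 in Ht.
        pose proof (smooth1_is_derive D f _ OD Sf (star x t Dx Ht)) as H.
        auto_derive; [eexists; exact H|]. change (fun x0 => f x0) with f. unfold Rminus; ring.
      - intros t Ht. apply H01 in Ht.
        apply (continuous_mult (fun _ => x - p)); [apply continuous_const|].
        apply (continuous_comp (fun t => p + (x - p) * t) (Derive f)).
        + apply (ex_derive_continuous (V := R_NormedModule)). auto_derive; easy.
        + apply (smooth_continuous (V := R_NormedModule) D (Derive f)).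
          * now apply smooth1_Derive.
          * now apply star. }
    replace (p + (x - p) * 1) with x in I by ring.
    replace (p + (x - p) * 0) with p in I by ring.
    rewrite f0 in I.
    assert (F : f x = RInt (fun t => (x - p) * Derive f (p + (x - p) * t)) 0 1).
    { symmetry. rewrite (is_RInt_unique _ _ _ _ I). unfold minus, plus, opp; simpl. ring. }
    rewrite F, <- (RInt_scal (V := R_CompleteNormedModule) _ 0 1 ((x - p) ^ S n)).
    + apply RInt_ext. intros t Ht. rewrite Rmin_left, Rmax_right in Ht by lra.
      rewrite E by (apply star; [easy|lra]).
      replace (p + (x - p) * t - p) with ((x - p) * t) by ring.
      rewrite Rpow_mult_distr. unfold scal; simpl. unfold mult; simpl. ring.
    + apply (ex_RInt_continuous (V := R_CompleteNormedModule)). intros t Ht.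
      rewrite Rmin_left, Rmax_right in Ht by lra.
      apply (continuous_mult (fun t => t ^ n)).
      * apply (ex_derive_continuous (V := R_NormedModule)). auto_derive; easy.
      * apply (continuous_comp (fun t => p + (x - p) * t) chi).
        -- apply (ex_derive_continuous (V := R_NormedModule)). auto_derive; easy.
        -- apply (smooth_continuous (V := R_NormedModule) D chi); [easy|now apply star].
Qed.

Lemma order_of_derivatives D p n f :
  open D -> D p -> starlike D p -> smooth1 D f ->
  (forall i, (i < n)%nat -> Derive_n f i p = 0) -> Derive_n f n p <> 0 ->
  has_order D p n f.
Proof.
  intros OD Dp star; revert f; induction n as [|n IH]; intros f Sf H0 H1.
  - exists f. split; [easy|split; [exact H1|]]. intros; simpl; ring.
  - assert (HS : forall i, Derive_n f (S i) p = Derive_n (Derive f) i p).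
    { intros i. rewrite <- Nat.add_1_r. symmetry. apply (Derive_n_comp f i 1). }
    apply order_primitive; try easy.
    + apply (H0 0%nat); lia.
    + apply IH.
      * now apply smooth1_Derive.
      * intros i Hi. rewrite <- HS. apply H0; lia.
      * now rewrite <- HS.
Qed.

Lemma order_mul D p n f g :
  smooth1 D g -> g p <> 0 -> has_order D p n f -> has_order D p n (fun x => f x * g x).
Proof.
  intros Sg Ng (chi & Schi & Nchi & E). exists (fun x => chi x * g x); repeat split.
  - now apply (smooth_mult (V := R_NormedModule)).
  - now apply Rmult_integral_contrapositive_currified.
  - intros x Dx. rewrite E by easy. ring.
Qed.

Lemma order_ext D p n f g :
  (forall x, D x -> f x = g x) -> has_order D p n f -> has_order D p n g.
Proof.
  intros H (chi & Schi & Nchi & E). exists chi; repeat split; try easy.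
  intros x Dx. rewrite <- H by easy. now apply E.
Qed.

(** * The implicit function theorem *)

Notation R2 := (prod_NormedModule R_AbsRing R_NormedModule R_NormedModule).
Notation smooth2 := (smooth (V := R2)).

Definition partial1 (H : R * R -> R) (z : R * R) : R :=
  Derive (fun y => H (y, snd z)) (fst z).
Definition partial2 (H : R * R -> R) (z : R * R) : R :=
  Derive (fun y => H (fst z, y)) (snd z).

(** The partial derivatives are the differential evaluated on the two basis
    vectors. *)
Lemma Ck2_partials n (D : R * R -> Prop) (H : R * R -> R) :
  open (T := R2) D -> Ck (V := R2) (S n) D H ->
  (forall y d, D (y, d) ->
     is_derive (fun x => H (x, d)) y (partial1 H (y, d)) /\
     is_derive (fun x => H (y, x)) d (partial2 H (y, d))) /\
  Ck (V := R2) n D (partial1 H) /\ Ck (V := R2) n D (partial2 H).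
Proof.
  intros OD (dH & HH & HdH).
  assert (P : forall y d, D (y, d) ->
     is_derive (fun x => H (x, d)) y (dH (y, d) (1, 0)) /\
     is_derive (fun x => H (y, x)) d (dH (y, d) (0, 1))).
  { intros y d Dyd. pose proof (HH _ Dyd) as F. pose proof (proj1 F) as L.
    assert (G : filterdiff (V := R_NormedModule) (fun t : R2 => H (fst t, snd t)) (locally (y, d))
                  (fun t : R2 => dH (y, d) (fst t, snd t))).
    { apply (filterdiff_ext (V := R_NormedModule) H); [now intros []|].
      eapply (filterdiff_ext_lin (V := R_NormedModule)); [exact F|now intros []]. }
    split; unfold is_derive.
    - eapply (filterdiff_ext_lin (V := R_NormedModule)).
      + apply (filterdiff_comp'_2
                 (T := R_NormedModule) (U := R_NormedModule) (V := R_NormedModule)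
                 (fun x => x) (fun _ => d) (fun a b => H (a, b)) y (fun v => v) (fun _ => 0)
                 (fun a b => dH (y, d) (a, b)));
          [apply filterdiff_id|apply (filterdiff_const (V := R_NormedModule))|exact G].
      + intros v. simpl. rewrite <- (linear_scal _ L). f_equal.
        unfold scal; simpl; unfold prod_scal, scal; simpl.
        symmetry; f_equal; [apply (Rmult_1_r v)|apply (Rmult_0_r v)].
    - eapply (filterdiff_ext_lin (V := R_NormedModule)).
      + apply (filterdiff_comp'_2
                 (T := R_NormedModule) (U := R_NormedModule) (V := R_NormedModule)
                 (fun _ => y) (fun x => x) (fun a b => H (a, b)) d (fun _ => 0) (fun v => v)
                 (fun a b => dH (y, d) (a, b)));
          [apply (filterdiff_const (V := R_NormedModule))|apply filterdiff_id|exact G].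
      + intros v. simpl. rewrite <- (linear_scal _ L). f_equal.
        unfold scal; simpl; unfold prod_scal, scal; simpl.
        symmetry; f_equal; [apply (Rmult_0_r v)|apply (Rmult_1_r v)]. }
  assert (E1 : forall z, D z -> dH z (1, 0) = partial1 H z).
  { intros [y d] Dz. symmetry. now apply is_derive_unique, P. }
  assert (E2 : forall z, D z -> dH z (0, 1) = partial2 H z).
  { intros [y d] Dz. symmetry. now apply is_derive_unique, P. }
  split; [|split].
  - intros y d Dyd. rewrite <- E1, <- E2 by easy. now apply P.
  - now apply (Ck_ext (V := R2)) with (fun z => dH z (1, 0)).
  - now apply (Ck_ext (V := R2)) with (fun z => dH z (0, 1)).
Qed.

Lemma smooth2_partials (D : R * R -> Prop) (H : R * R -> R) :
  open (T := R2) D -> smooth2 D H ->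
  (forall y d, D (y, d) ->
     is_derive (fun x => H (x, d)) y (partial1 H (y, d)) /\
     is_derive (fun x => H (y, x)) d (partial2 H (y, d))) /\
  smooth2 D (partial1 H) /\ smooth2 D (partial2 H).
Proof.
  intros OD SH. split; [|split].
  - now apply (Ck2_partials 0).
  - intros n. now apply (Ck2_partials n).
  - intros n. now apply (Ck2_partials n).
Qed.

Lemma locally2_box (P : R * R -> Prop) (y d : R) :
  locally (T := R2) (y, d) P ->
  exists r, 0 < r /\ forall y' d', Rabs (y' - y) < r -> Rabs (d' - d) < r -> P (y', d').
Proof.
  intros [eps He]. exists eps; split; [apply cond_pos|].
  intros y' d' Hy Hd. apply He. now split.
Qed.

Lemma smooth2_continuous (D : R * R -> Prop) (H : R * R -> R) z :
  smooth2 D H -> D z -> continuous (T := R2) (U := R_UniformSpace) H z.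
Proof. intros SH Dz. now apply (smooth_continuous (V := R2) D). Qed.

Lemma MVT_between (f df : R -> R) (a b : R) :
  (forall x, Rmin a b <= x <= Rmax a b -> is_derive f x (df x)) ->
  exists c, Rmin a b <= c <= Rmax a b /\ f b - f a = df c * (b - a).
Proof.
  intros H. apply MVT_gen.
  - intros x Hx. apply H; lra.
  - intros x Hx. apply continuity_pt_filterlim.
    apply (ex_derive_continuous (V := R_NormedModule)). eexists. now apply H.
Qed.

Lemma between_ball (a b c p r : R) :
  Rabs (a - p) < r -> Rabs (b - p) < r -> Rmin a b <= c <= Rmax a b -> Rabs (c - p) < r.
Proof.
  intros Ha Hb Hc. apply Rabs_def2 in Ha. apply Rabs_def2 in Hb. apply Rabs_def1;
  unfold Rmin, Rmax in Hc; destruct (Rle_dec a b); lra.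
Qed.

(** Monotonicity in the first variable and the intermediate value theorem give
    the solution [q]; the mean value theorem in each variable makes it Lipschitz,
    then differentiable with [q' = G (q, id)] for the smooth function
    [G = - partial2 H / partial1 H]. This differential equation bootstraps [q]
    from continuous to smooth. *)
Lemma implicit_function_pos (D : R * R -> Prop) (H : R * R -> R) (q0 d0 l rho : R) :
  open (T := R2) D -> D (q0, d0) -> smooth2 D H -> H (q0, d0) = 0 ->
  is_derive (fun y => H (y, d0)) q0 l -> 0 < l -> 0 < rho ->
  exists (r e : R) (q : R -> R), 0 < r <= rho /\ 0 < e /\
    smooth1 (fun d => Rabs (d - d0) < e) q /\
    (forall d, Rabs (d - d0) < e -> Rabs (q d - q0) < r /\ H (q d, d) = 0) /\
    (forall y d, Rabs (y - q0) < r -> Rabs (d - d0) < e -> H (y, d) = 0 -> y = q d).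
Proof.
  intros OD D0 SH H0 Hl Lpos Rpos.
  destruct (smooth2_partials D H OD SH) as (Hp & S1 & S2).
  assert (L0 : partial1 H (q0, d0) = l) by now apply is_derive_unique.
  assert (Box : exists r0, 0 < r0 /\ forall y d, Rabs (y - q0) < r0 -> Rabs (d - d0) < r0 ->
     D (y, d) /\ l / 2 < partial1 H (y, d) /\
     Rabs (partial2 H (y, d)) < Rabs (partial2 H (q0, d0)) + 1).
  { apply locally2_box with (P := fun z => D z /\ l / 2 < partial1 H z /\
       Rabs (partial2 H z) < Rabs (partial2 H (q0, d0)) + 1).
    apply filter_and; [now apply OD|apply filter_and].
    - apply (smooth2_continuous D (partial1 H) _ S1 D0 (fun t => l / 2 < t)).
      apply open_gt. rewrite L0. lra.
    - apply (smooth2_continuous D (partial2 H) _ S2 D0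
               (fun t => Rabs t < Rabs (partial2 H (q0, d0)) + 1)).
      exists (mkposreal 1 Rlt_0_1). intros t Ht.
      change (Rabs (t - partial2 H (q0, d0)) < 1) in Ht.
      pose proof (Rabs_triang_inv t (partial2 H (q0, d0))). lra. }
  destruct Box as (r0 & r0pos & Box).
  set (M := Rabs (partial2 H (q0, d0)) + 1) in Box.
  assert (HD1 : forall y d, Rabs (y - q0) < r0 -> Rabs (d - d0) < r0 ->
    is_derive (fun x => H (x, d)) y (partial1 H (y, d))).
  { intros y d Hy Hd. exact (proj1 (Hp y d (proj1 (Box y d Hy Hd)))). }
  assert (HD2 : forall y d, Rabs (y - q0) < r0 -> Rabs (d - d0) < r0 ->
    is_derive (fun x => H (y, x)) d (partial2 H (y, d))).
  { intros y d Hy Hd. exact (proj2 (Hp y d (proj1 (Box y d Hy Hd)))). }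
  assert (B1 : forall y d, Rabs (y - q0) < r0 -> Rabs (d - d0) < r0 -> l / 2 < partial1 H (y, d)).
  { intros y d Hy Hd. exact (proj1 (proj2 (Box y d Hy Hd))). }
  assert (B2 : forall y d, Rabs (y - q0) < r0 -> Rabs (d - d0) < r0 -> Rabs (partial2 H (y, d)) < M).
  { intros y d Hy Hd. exact (proj2 (proj2 (Box y d Hy Hd))). }
  set (r := Rmin (r0 / 2) rho).
  assert (rpos : 0 < r) by (apply Rmin_pos; lra).
  assert (rr0 : r < r0) by (unfold r; pose proof (Rmin_l (r0 / 2) rho); lra).
  assert (rrho : r <= rho) by apply Rmin_r.
  assert (Mono : forall d y1 y2, Rabs (d - d0) < r0 -> Rabs (y1 - q0) < r0 -> Rabs (y2 - q0) < r0 ->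
    y1 < y2 -> H (y1, d) < H (y2, d)).
  { intros d y1 y2 Hd H1 H2 H12.
    destruct (MVT_between (fun y => H (y, d)) (fun y => partial1 H (y, d)) y1 y2) as (c & Hc & E).
    - intros x Hx. apply HD1; [|easy]. now apply (between_ball y1 y2).
    - assert (0 < partial1 H (c, d)).
      { apply Rlt_trans with (l / 2); [lra|]. apply B1; [|easy]. now apply (between_ball y1 y2). }
      nra. }
  assert (Dd0 : Rabs (d0 - d0) < r0) by (rewrite Rminus_diag_eq, Rabs_R0; lra).
  assert (Dq0 : Rabs (q0 - q0) < r0) by (rewrite Rminus_diag_eq, Rabs_R0; lra).
  assert (Dp : Rabs (q0 + r - q0) < r0) by (apply Rabs_def1; lra).
  assert (Dm : Rabs (q0 - r - q0) < r0) by (apply Rabs_def1; lra).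
  assert (Ends : exists e, 0 < e /\ e <= r0 /\ forall d, Rabs (d - d0) < e ->
     0 < H (q0 + r, d) /\ H (q0 - r, d) < 0).
  { assert (C : forall y, Rabs (y - q0) < r0 -> continuous (fun d => H (y, d)) d0).
    { intros y Hy. apply (ex_derive_continuous (V := R_NormedModule)).
      eexists. apply HD2; [exact Hy|exact Dd0]. }
    assert (F : locally d0 (fun d => 0 < H (q0 + r, d) /\ H (q0 - r, d) < 0)).
    { apply filter_and.
      - apply (C _ Dp (fun t => 0 < t)). apply open_gt. rewrite <- H0. apply Mono; try easy. lra.
      - apply (C _ Dm (fun t => t < 0)). apply open_lt. rewrite <- H0. apply Mono; try easy. lra. }
    destruct F as [e He]. exists (Rmin e r0). split; [apply Rmin_pos; [apply cond_pos|easy]|].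
    split; [apply Rmin_r|]. intros d Hd. apply He.
    apply Rlt_le_trans with (1 := Hd), Rmin_l. }
  destruct Ends as (e & epos & er0 & Ends).
  (* A choice of zeros by a decidable test, since the intermediate value theorem
     is informative. *)
  assert (Q : forall d, { y | Rabs (d - d0) < e -> Rabs (y - q0) < r /\ H (y, d) = 0 }).
  { intros d. destruct (Rlt_dec (Rabs (d - d0)) e) as [Hd|Hd]; [|now exists 0; intros].
    destruct (Ends d Hd) as [Ep Em].
    destruct (IVT_interv (fun y => H (y, d)) (q0 - r) (q0 + r)) as (y & Hy & Ey); try lra.
    - intros y Hy. apply continuity_pt_filterlim.
      apply (ex_derive_continuous (V := R_NormedModule)). eexists.
      apply HD1; [apply Rabs_def1; lra|lra].
    - exists y; intros _; split; [|easy].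
      apply Rabs_def1.
      + destruct (Req_dec y (q0 + r)) as [->|]; lra.
      + destruct (Req_dec y (q0 - r)) as [->|]; lra. }
  set (q := fun d => proj1_sig (Q d)).
  assert (Hq : forall d, Rabs (d - d0) < e -> Rabs (q d - q0) < r /\ H (q d, d) = 0).
  { intros d. exact (proj2_sig (Q d)). }
  exists r, e, q. split; [easy|]. split; [easy|].
  assert (Uniq : forall y d, Rabs (y - q0) < r -> Rabs (d - d0) < e -> H (y, d) = 0 -> y = q d).
  { intros y d Hy Hd Ey. destruct (Hq d Hd) as [Hqd Eqd].
    destruct (Rtotal_order y (q d)) as [L|[L|L]]; [|easy|].
    - apply (Mono d) in L; lra.
    - apply (Mono d) in L; lra. }
  split; [|now split].
  (* The increment of q is controlled by the mean value theorem in each variable. *)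
  assert (Incr : forall d d', Rabs (d - d0) < e -> Rabs (d' - d0) < e ->
    exists xi eta, Rmin (q d) (q d') <= xi <= Rmax (q d) (q d') /\
      Rmin d d' <= eta <= Rmax d d' /\
      q d' - q d = - partial2 H (q d, eta) / partial1 H (xi, d') * (d' - d)).
  { intros d d' Hd Hd'.
    destruct (Hq d Hd) as [Hqd Ed], (Hq d' Hd') as [Hqd' Ed'].
    destruct (MVT_between (fun y => H (y, d')) (fun y => partial1 H (y, d')) (q d) (q d'))
      as (xi & Hxi & Exi).
    { intros x Hx. apply HD1; [apply (between_ball (q d) (q d')); lra|lra]. }
    destruct (MVT_between (fun x => H (q d, x)) (fun x => partial2 H (q d, x)) d d')
      as (eta & Heta & Eeta).
    { intros x Hx. apply HD2; [lra|apply (between_ball d d'); lra]. }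
    exists xi, eta. split; [easy|split; [easy|]].
    assert (l / 2 < partial1 H (xi, d')).
    { apply B1; [apply (between_ball (q d) (q d')); lra|lra]. }
    rewrite Ed' in Exi. rewrite Ed in Eeta.
    field_simplify_eq; [|lra]. lra. }
  assert (Cont : forall d, Rabs (d - d0) < e -> continuous q d).
  { intros d Hd.
    assert (Lip : forall d', Rabs (d' - d0) < e -> Rabs (q d' - q d) <= M / (l / 2) * Rabs (d' - d)).
    { intros d' Hd'. destruct (Incr d d' Hd Hd') as (xi & eta & Hxi & Heta & E).
      destruct (Hq d Hd) as [Hqd _], (Hq d' Hd') as [Hqd' _].
      rewrite E, Rabs_mult. apply Rmult_le_compat_r; [apply Rabs_pos|].
      assert (P1 : l / 2 < partial1 H (xi, d')).
      { apply B1; [apply (between_ball (q d) (q d')); lra|lra]. }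
      assert (P2 : Rabs (partial2 H (q d, eta)) < M).
      { apply B2; [lra|apply (between_ball d d'); lra]. }
      unfold Rdiv. rewrite Rabs_mult, Rabs_Ropp, Rabs_inv, (Rabs_pos_eq (partial1 _ _)) by lra.
      apply Rmult_le_compat; [apply Rabs_pos| |lra|].
      - apply Rlt_le, Rinv_0_lt_compat; lra.
      - apply Rinv_le_contravar; lra. }
    assert (Mpos : 0 < M) by (unfold M; pose proof (Rabs_pos (partial2 H (q0, d0))); lra).
    intros P [eps HP].
    assert (epos' : 0 < Rmin (e - Rabs (d - d0)) (eps * (l / 2 / M))).
    { apply Rmin_pos; [lra|]. apply Rmult_lt_0_compat; [apply cond_pos|].
      apply Rdiv_lt_0_compat; lra. }
    exists (mkposreal _ epos'). intros d' Hd'.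
    change (Rabs (d' - d) < Rmin (e - Rabs (d - d0)) (eps * (l / 2 / M))) in Hd'.
    apply HP. change (Rabs (q d' - q d) < eps).
    apply Rle_lt_trans with (M / (l / 2) * Rabs (d' - d)).
    - apply Lip. pose proof (Rmin_l (e - Rabs (d - d0)) (eps * (l / 2 / M))).
      replace (d' - d0) with ((d' - d) + (d - d0)) by ring.
      pose proof (Rabs_triang (d' - d) (d - d0)). lra.
    - apply Rlt_le_trans with (M / (l / 2) * (eps * (l / 2 / M))).
      + apply Rmult_lt_compat_l; [apply Rdiv_lt_0_compat; lra|].
        pose proof (Rmin_r (e - Rabs (d - d0)) (eps * (l / 2 / M))). lra.
      + apply Req_le. field. lra. }
  set (G := fun z => - partial2 H z / partial1 H z).
  assert (Der : forall d, Rabs (d - d0) < e -> is_derive q d (G (q d, d))).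
  { intros d Hd. destruct (Hq d Hd) as [Hqd _].
    set (p := (q d, d)).
    assert (Dpp : D p) by (apply Box; lra).
    assert (P1 : 0 < partial1 H p) by (apply Rlt_trans with (l / 2); [lra|]; apply B1; lra).
    assert (CPhi : continuous (T := prod_UniformSpace R2 R2) (U := R_UniformSpace)
       (fun w => - partial2 H (fst w) / partial1 H (snd w)) (p, p)).
    { apply (continuous_mult (U := prod_UniformSpace R2 R2) (K := R_AbsRing)
         (fun w => - partial2 H (fst w)) (fun w => / partial1 H (snd w))).
      - apply (continuous_opp (U := prod_UniformSpace R2 R2) (V := R_NormedModule)
           (fun w => partial2 H (fst w))).
        apply (continuous_comp (U := prod_UniformSpace R2 R2) (V := R2) (W := R_UniformSpace)
           fst (partial2 H)).
        + apply (continuous_fst (U := R2) (V := R2)).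
        + now apply (smooth2_continuous D).
      - apply (continuous_comp (U := prod_UniformSpace R2 R2) (V := R_UniformSpace) (W := R_UniformSpace)
           (fun w => partial1 H (snd w)) Rinv).
        + apply (continuous_comp (U := prod_UniformSpace R2 R2) (V := R2) (W := R_UniformSpace)
             snd (partial1 H)).
          * apply (continuous_snd (U := R2) (V := R2)).
          * now apply (smooth2_continuous D).
        + apply continuous_Rinv. simpl. lra. }
    apply is_derive_Reals. intros eps Heps.
    assert (B : locally (T := R_UniformSpace) (G p) (fun t => Rabs (t - G p) < eps)).
    { exists (mkposreal eps Heps). now intros t Ht. }
    destruct (CPhi _ B) as [del Hdel].
    assert (Bq : locally (q d) (fun y => Rabs (y - q d) < del)).
    { exists del. now intros y Hy. }
    destruct (Cont d Hd _ Bq) as [del' Hdel'].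
    assert (dpos : 0 < Rmin (Rmin del del') (e - Rabs (d - d0))).
    { repeat apply Rmin_pos; try apply cond_pos. lra. }
    exists (mkposreal _ dpos). intros h Nh Hh. simpl in Hh.
    pose proof (Rmin_l (Rmin del del') (e - Rabs (d - d0))).
    pose proof (Rmin_r (Rmin del del') (e - Rabs (d - d0))).
    pose proof (Rmin_l del del'). pose proof (Rmin_r del del').
    assert (Hd' : Rabs (d + h - d0) < e).
    { replace (d + h - d0) with (h + (d - d0)) by ring.
      pose proof (Rabs_triang h (d - d0)). lra. }
    destruct (Incr d (d + h) Hd Hd') as (xi & eta & Hxi & Heta & E).
    assert (Hqh : Rabs (q (d + h) - q d) < del).
    { apply Hdel'. change (Rabs (d + h - d) < del'). replace (d + h - d) with h by ring. lra. }
    rewrite E. replace (d + h - d) with h by ring.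
    replace (- partial2 H (q d, eta) / partial1 H (xi, d + h) * h / h)
      with (- partial2 H (q d, eta) / partial1 H (xi, d + h)).
    2:{ field. split; [|easy]. apply Rgt_not_eq. apply Rlt_trans with (l / 2); [lra|].
        apply B1; [|lra]. apply (between_ball (q d) (q (d + h))); try easy.
        - lra.
        - pose proof (proj1 (Hq _ Hd')). lra. }
    assert (Zq : Rabs (q d - q d) < del) by (rewrite Rminus_diag_eq, Rabs_R0; [apply cond_pos|easy]).
    assert (Zd : Rabs (d - d) < del) by (rewrite Rminus_diag_eq, Rabs_R0; [apply cond_pos|easy]).
    assert (Zh : Rabs (d + h - d) < del) by (replace (d + h - d) with h by ring; lra).
    assert (Be : Rabs (eta - d) < del) by exact (between_ball d (d + h) eta d del Zd Zh Heta).
    assert (Bx : Rabs (xi - q d) < del)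
      by exact (between_ball (q d) (q (d + h)) xi (q d) del Zq Hqh Hxi).

    exact (Hdel ((q d, eta), (xi, d + h)) (conj (conj Zq Be) (conj Bx Zh))). }

  assert (SG : smooth2 (fun z => Rabs (fst z - q0) < r /\ Rabs (snd z - d0) < e) G).
  { apply (smooth_div (V := R2)).
    - intros [y d] [Hy Hd]. apply Rgt_not_eq. simpl in *.
      apply Rlt_trans with (l / 2); [lra|]. apply B1; lra.
    - apply (smooth_opp (V := R2)), (smooth_subset (V := R2) D); [|easy].
      intros [y d] [Hy Hd]. simpl in *. apply Box; lra.
    - apply (smooth_subset (V := R2) D); [|easy].
      intros [y d] [Hy Hd]. simpl in *. apply Box; lra. }

  intros n; induction n as [|n IH].
  - exact Cont.
  - apply Ck1_S with (fun d => G (q d, d)); [exact Der|].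
    apply (Ck_comp2 (V := R_NormedModule)) with
      (fun z => Rabs (fst z - q0) < r /\ Rabs (snd z - d0) < e).
    + intros d Hd. simpl. split; [now apply Hq|easy].
    + apply SG.
    + exact IH.
    + apply smooth1_id.
Qed.

Lemma implicit_function (D : R * R -> Prop) (H : R * R -> R) (q0 d0 l rho : R) :
  open (T := R2) D -> D (q0, d0) -> smooth2 D H -> H (q0, d0) = 0 ->
  is_derive (fun y => H (y, d0)) q0 l -> l <> 0 -> 0 < rho ->
  exists (r e : R) (q : R -> R), 0 < r <= rho /\ 0 < e /\
    smooth1 (fun d => Rabs (d - d0) < e) q /\
    (forall d, Rabs (d - d0) < e -> Rabs (q d - q0) < r /\ H (q d, d) = 0) /\
    (forall y d, Rabs (y - q0) < r -> Rabs (d - d0) < e -> H (y, d) = 0 -> y = q d).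
Proof.
  intros OD D0 SH H0 Hl Nl Rpos.
  destruct (Rlt_le_dec 0 l) as [Lpos|Lneg].
  - now apply (implicit_function_pos D H q0 d0 l rho).
  - destruct (implicit_function_pos D (fun z => - H z) q0 d0 (- l) rho)
      as (r & e & q & Hr & He & Sq & Hq & Uq); try easy; try lra.
    + now apply (smooth_opp (V := R2)).
    + apply (is_derive_opp (V := R_NormedModule) (fun y => H (y, d0))). exact Hl.
    + exists r, e, q. do 3 (split; [easy|]). split.
      * intros d Hd. destruct (Hq d Hd). split; [easy|lra].
      * intros y d Hy Hd Ey. apply Uq; try easy. lra.
Qed.

(** * The trapezoid rule *)

(** The defect of the trapezoid rule for [f1 = f'] between [b] and [a], doubled. It
    vanishes exactly when some quadratic polynomial has the values and slopes of
    [f] at both [a] and [b]; in particular it ignores quadratic terms of [f]. *)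
Definition trapezoid (f f1 : R -> R) (a b : R) : R := 2 * (f a - f b) - (a - b) * (f1 a + f1 b).

Lemma MVT_strict (f df : R -> R) (a b : R) : a < b ->
  (forall x, a <= x <= b -> is_derive f x (df x)) ->
  exists c, a < c < b /\ f b - f a = df c * (b - a).
Proof.
  intros Hab H. destruct (MVT_cor2 f df a b Hab) as (c & E & Hc).
  - intros x Hx. now apply is_derive_Reals, H.
  - now exists c.
Qed.

(** As a function of [a] the defect vanishes at [b] and has derivative
    [f'(a) - f'(b) - (a - b) f''(a)]: Rolle's theorem followed by the mean value
    theorem. *)
Lemma trapezoid_zero (f f1 f2 : R -> R) (a b : R) : b < a ->
  (forall x, b <= x <= a -> is_derive f x (f1 x)) ->
  (forall x, b <= x <= a -> is_derive f1 x (f2 x)) ->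
  trapezoid f f1 a b = 0 ->
  exists eta xi, b < eta /\ eta < xi /\ xi < a /\ f2 eta = f2 xi.
Proof.
  intros Hab H1 H2 E.
  destruct (MVT_strict (fun x => trapezoid f f1 x b) (fun x => f1 x - f1 b - (x - b) * f2 x) b a Hab)
    as (xi & Hxi & Exi).
  - intros x Hx. pose proof (H1 x Hx) as D1. pose proof (H2 x Hx) as D2.
    unfold trapezoid. auto_derive.
    + split; [eexists; exact D1|split; [eexists; exact D2|easy]].
    + change (fun x0 => f x0) with f. change (fun x0 => f1 x0) with f1.
      rewrite (is_derive_unique _ _ _ D1), (is_derive_unique _ _ _ D2). ring.
  - assert (E0 : trapezoid f f1 b b = 0) by (unfold trapezoid; ring).
    rewrite E, E0 in Exi.
    assert (Z : f1 xi - f1 b - (xi - b) * f2 xi = 0) by nra.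
    destruct (MVT_strict f1 f2 b xi) as (eta & Heta & Eeta); [lra|intros x Hx; apply H2; lra|].
    exists eta, xi. repeat split; try lra.
    apply Rmult_eq_reg_r with (xi - b); lra.
Qed.

(** The classical error term, obtained by subtracting the cubic that makes the
    defect vanish. *)
Lemma trapezoid_error (f f1 f2 f3 : R -> R) (a b : R) : b < a ->
  (forall x, b <= x <= a -> is_derive f x (f1 x)) ->
  (forall x, b <= x <= a -> is_derive f1 x (f2 x)) ->
  (forall x, b <= x <= a -> is_derive f2 x (f3 x)) ->
  exists zeta, b < zeta < a /\ trapezoid f f1 a b = - f3 zeta / 6 * (a - b) ^ 3.
Proof.
  intros Hab H1 H2 H3.
  set (K := - 6 * trapezoid f f1 a b / (a - b) ^ 3).
  destruct (trapezoid_zero (fun x => f x - K / 6 * x ^ 3) (fun x => f1 x - K / 2 * x ^ 2)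
              (fun x => f2 x - K * x) a b Hab) as (eta & xi & He & Hx & Ha & E).
  - intros x Hx. pose proof (H1 x Hx) as D1. auto_derive; [eexists; exact D1|].
    change (fun x0 => f x0) with f. rewrite (is_derive_unique _ _ _ D1). field.
  - intros x Hx. pose proof (H2 x Hx) as D1. auto_derive; [eexists; exact D1|].
    change (fun x0 => f1 x0) with f1. rewrite (is_derive_unique _ _ _ D1). field.
  - transitivity (trapezoid f f1 a b + K / 6 * (a - b) ^ 3); [unfold trapezoid; field|].
    unfold K. field. lra.
  - destruct (MVT_strict f2 f3 eta xi Hx) as (zeta & Hz & Ez); [intros x Hx'; apply H3; lra|].
    exists zeta. split; [lra|].
    assert (EK : f3 zeta = K) by (apply Rmult_eq_reg_r with (xi - eta); lra).
    rewrite EK. unfold K. field. lra.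
Qed.

Lemma trapezoid_nonzero (f f1 f2 : R -> R) (e a b : R) :
  (forall x, Rabs x < e -> is_derive f x (f1 x)) ->
  (forall x, Rabs x < e -> is_derive f1 x (f2 x)) ->
  (forall x y, Rabs x < e -> Rabs y < e -> f2 x = f2 y -> x = y) ->
  Rabs a < e -> Rabs b < e -> a <> b -> trapezoid f f1 a b <> 0.
Proof.
  intros H1 H2 Inj.
  assert (W : forall a b, Rabs a < e -> Rabs b < e -> b < a -> trapezoid f f1 a b <> 0).
  { clear a b. intros a b Ha Hb Hab E. apply Rabs_def2 in Ha, Hb.
    destruct (trapezoid_zero f f1 f2 a b Hab) as (eta & xi & ? & ? & ? & E2); try easy.
    - intros x Hx. apply H1, Rabs_def1; lra.
    - intros x Hx. apply H2, Rabs_def1; lra.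
    - apply Inj in E2; [lra| |]; apply Rabs_def1; lra. }
  intros Ha Hb Hab. destruct (Rtotal_order a b) as [L|[L|L]]; [|easy|now apply W].
  intros E. apply (W b a Hb Ha L). unfold trapezoid in *. lra.
Qed.

Lemma order_sign D n f : open D -> D 0 -> has_order D 0 n f ->
  exists e c, 0 < e /\ c <> 0 /\ forall x, Rabs x < e -> D x /\ (x <> 0 -> 0 < f x * (c * x ^ n)).
Proof.
  intros OD D0 (chi & Schi & Nchi & E).
  assert (C : locally 0 (fun x => D x /\ 0 < chi x * chi 0)).
  { apply filter_and; [now apply OD|].
    assert (Cc : continuous (fun x => chi x * chi 0) 0).
    { apply (continuous_mult chi (fun _ => chi 0)); [|apply continuous_const].
      now apply (smooth_continuous (V := R_NormedModule) D). }
    apply (Cc (fun t => 0 < t)). apply open_gt. now apply Rsqr_pos_lt. }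
  destruct C as [e He]. exists e, (chi 0). split; [apply cond_pos|split; [easy|]].
  intros x Hx. destruct (He x) as [Dx Px].
  { change (Rabs (x - 0) < e). now rewrite Rminus_0_r. }
  split; [easy|]. intros Nx. rewrite E, Rminus_0_r by easy.
  replace (x ^ n * chi x * (chi 0 * x ^ n)) with (Rsqr (x ^ n) * (chi x * chi 0))
    by (unfold Rsqr; ring).
  apply Rmult_lt_0_compat; [|easy]. apply Rsqr_pos_lt. now apply pow_nonzero.
Qed.

(** The derivative keeps one strict sign off the origin, and strict monotonicity
    survives a single critical point. *)
Lemma injective_of_even_order D m (f f1 : R -> R) : open D -> D 0 ->
  (forall x, D x -> is_derive f x (f1 x)) -> has_order D 0 (2 * m) f1 ->
  exists e, 0 < e /\ (forall x, Rabs x < e -> D x) /\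
    forall x y, Rabs x < e -> Rabs y < e -> f x = f y -> x = y.
Proof.
  intros OD D0 Hf Ho. destruct (order_sign D _ f1 OD D0 Ho) as (e & c & epos & Nc & He).
  exists e. split; [easy|]. split; [intros x Hx; now apply He|].
  assert (S : forall x, Rabs x < e -> x <> 0 -> 0 < f1 x * c).
  { intros x Hx Nx. destruct (He x Hx) as [_ P]. specialize (P Nx).
    assert (0 < x ^ (2 * m)).
    { rewrite pow_mult. apply pow_lt. rewrite <- Rsqr_pow2. now apply Rsqr_pos_lt. }
    apply Rmult_lt_reg_r with (x ^ (2 * m)); [easy|]. lra. }
  assert (M : forall x y, Rabs x < e -> Rabs y < e -> x < y -> 0 <= x \/ y <= 0 ->
            0 < (f y - f x) * c).
  { intros x y Hx Hy Hxy Hs. apply Rabs_def2 in Hx, Hy.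
    destruct (MVT_strict f f1 x y Hxy) as (z & Hz & Ez).
    - intros z Hz. apply Hf, He, Rabs_def1; lra.
    - rewrite Ez. replace (f1 z * (y - x) * c) with (f1 z * c * (y - x)) by ring.
      apply Rmult_lt_0_compat; [|lra]. apply S; [apply Rabs_def1; lra|lra]. }
  assert (M' : forall x y, Rabs x < e -> Rabs y < e -> x < y -> f x <> f y).
  { intros x y Hx Hy Hxy Exy.
    assert (H0 : Rabs 0 < e) by now rewrite Rabs_R0.
    destruct (Rle_lt_dec 0 x) as [Lx|Lx]; [|destruct (Rle_lt_dec y 0) as [Ly|Ly]].
    - pose proof (M x y Hx Hy Hxy (or_introl Lx)). rewrite Exy in *. lra.
    - pose proof (M x y Hx Hy Hxy (or_intror Ly)). rewrite Exy in *. lra.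
    - pose proof (M x 0 Hx H0 Lx (or_intror (Rle_refl 0))).
      pose proof (M 0 y H0 Hy Ly (or_introl (Rle_refl 0))). rewrite Exy in *. lra. }
  intros x y Hx Hy Exy. destruct (Rtotal_order x y) as [L|[L|L]]; [|easy|].
  - now apply M' in L.
  - symmetry in Exy. now apply M' in L.
Qed.

Definition ball0 (e x : R) : Prop := Rabs x < e.

Lemma open_ball0 e : open (ball0 e).
Proof.
  intros x Hx. unfold ball0 in *.
  assert (P : 0 < e - Rabs x) by lra. exists (mkposreal _ P). intros y Hy.
  change (Rabs (y - x) < e - Rabs x) in Hy.
  replace y with ((y - x) + x) by ring. pose proof (Rabs_triang (y - x) x). lra.
Qed.

(** The third derivative of [J] has even order [2 m], so [J''] is injective. *)
Lemma trapezoid_isolated e1 (J : R -> R) m :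
  0 < e1 -> smooth1 (ball0 e1) J -> has_order (ball0 e1) 0 (2 * m + 3) J ->
  exists e, 0 < e <= e1 /\
    forall a b, Rabs a < e -> Rabs b < e -> a <> b -> trapezoid J (Derive J) a b <> 0.
Proof.
  intros epos SJ HJ.
  pose proof (open_ball0 e1) as OD.
  assert (D0 : ball0 e1 0) by (unfold ball0; now rewrite Rabs_R0).
  replace (2 * m + 3)%nat with (S (S (S (2 * m)))) in HJ by lia.
  do 3 apply order_derive in HJ; try easy.
  pose proof (smooth1_Derive _ _ OD SJ) as S1.
  pose proof (smooth1_Derive _ _ OD S1) as S2.
  destruct (injective_of_even_order _ m _ _ OD D0
    (fun x => smooth1_is_derive _ _ x OD S2) HJ) as (e & Pe & He & Inj).
  exists (Rmin e e1). split; [split; [now apply Rmin_pos|apply Rmin_r]|].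
  intros a b Ha Hb. pose proof (Rmin_l e e1).
  apply (trapezoid_nonzero _ _ (Derive (Derive J)) e); try easy; try lra;
    intros x Hx; apply (smooth1_is_derive (ball0 e1)); auto.
Qed.

(** Along the direction of the diagonal the difference of the arguments is fixed,
    so differentiating the defect of [J] gives the defect of [J']. *)
Lemma trapezoid_shear_derive (J : R -> R) e x d : smooth1 (ball0 e) J ->
  Rabs (x + d) < e -> Rabs (x - d) < e ->
  is_derive (fun x => trapezoid J (Derive J) (x + d) (x - d)) x
    (trapezoid (Derive J) (Derive (Derive J)) (x + d) (x - d)).
Proof.
  intros SJ Hp Hm. pose proof (open_ball0 e) as OD.
  pose proof (smooth1_Derive _ _ OD SJ) as S1.
  pose proof (smooth1_is_derive _ _ _ OD SJ Hp) as D1.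
  pose proof (smooth1_is_derive _ _ _ OD SJ Hm) as D2.
  pose proof (smooth1_is_derive _ _ _ OD S1 Hp) as D3.
  pose proof (smooth1_is_derive _ _ _ OD S1 Hm) as D4.
  generalize dependent (Derive (Derive J)). intros J2 D3 D4.
  generalize dependent (Derive J). intros J1 S1 D1 D2 D3 D4.
  unfold trapezoid. unfold Rminus in *. auto_derive.
  - repeat split; eexists; eassumption.
  - change (fun x0 => J x0) with J. change (fun x0 => J1 x0) with J1.
    rewrite (is_derive_unique _ _ _ D1), (is_derive_unique _ _ _ D2),
      (is_derive_unique _ _ _ D3), (is_derive_unique _ _ _ D4). ring.
Qed.

(** Uniqueness on each line of fixed difference [2 d]: the defect of [J] there has
    derivative the defect of [J'], which does not vanish since [J'''] is injective
    (its derivative has even order). Existence and smoothness: with [x = d q] and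
    [J = x^n chi], the defect is [d^n H (q, d)] for an explicit smooth [H] with a
    simple zero in [q] at the origin, so the branch is [x = d q(d)], tangent to
    the line [x = 0]. *)
Lemma trapezoid_branch e1 (J : R -> R) m :
  0 < e1 -> smooth1 (ball0 e1) J -> has_order (ball0 e1) 0 (2 * m + 4) J ->
  exists eps e p, 0 < e /\ e <= eps /\ 2 * eps <= e1 /\ smooth1 (ball0 e) p /\
    p 0 = 0 /\ is_derive p 0 0 /\
    (forall d, Rabs d < e -> Rabs (p d) < eps /\ trapezoid J (Derive J) (p d + d) (p d - d) = 0) /\
    (forall x d, Rabs x < eps -> Rabs d < e -> d <> 0 ->
       trapezoid J (Derive J) (x + d) (x - d) = 0 -> x = p d).
Proof.
  intros e1pos SJ HJ.
  pose proof (open_ball0 e1) as OD.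
  assert (D0 : ball0 e1 0) by (unfold ball0; now rewrite Rabs_R0).
  pose proof (smooth1_Derive _ _ OD SJ) as S1.
  pose proof (smooth1_Derive _ _ OD S1) as S2.
  pose proof (smooth1_Derive _ _ OD S2) as S3.
  assert (Inj : exists e, 0 < e /\ (forall x, Rabs x < e -> ball0 e1 x) /\
    forall x y, Rabs x < e -> Rabs y < e ->
      Derive (Derive (Derive J)) x = Derive (Derive (Derive J)) y -> x = y).
  { revert HJ. replace (2 * m + 4)%nat with (S (S (S (S (2 * m))))) by lia. intros HJ.
    do 4 apply order_derive in HJ; try easy.
    exact (injective_of_even_order _ m _ _ OD D0
      (fun x => smooth1_is_derive _ _ x OD S3) HJ). }
  destruct Inj as (e2 & e2pos & He2 & Inj).
  destruct HJ as (chi & Schi & Nchi & EJ).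
  replace (2 * m + 4)%nat with (S (2 * m + 3)) in EJ by lia.
  (* From here on the order of J is S n, which is even. *)
  set (n := (2 * m + 3)%nat) in *.
  set (chi1 := fun x => INR (S n) * chi x + x * Derive chi x).
  assert (Schi1 : smooth1 (ball0 e1) chi1).
  { apply (smooth_plus (V := R_NormedModule)); apply (smooth_mult (V := R_NormedModule));
      [apply smooth_const|easy|apply smooth1_id|now apply smooth1_Derive]. }
  assert (EJ1 : forall x, ball0 e1 x -> Derive J x = x ^ n * chi1 x).
  { intros x Dx. apply is_derive_unique.
    apply (is_derive_ext_loc (fun y => y ^ S n * chi y)).
    { apply filter_imp with (2 := OD x Dx). intros y Dy. rewrite EJ by easy.
      now rewrite Rminus_0_r. }
    pose proof (smooth1_is_derive _ chi x OD Schi Dx) as H.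
    auto_derive; [eexists; exact H|].
    change (fun x0 => chi x0) with chi. unfold chi1.
    change (match n with 0%nat => 1 | S _ => INR n + 1 end) with (INR (S n)). simpl pred.
    ring. }
  set (H := fun z : R * R =>
     2 * ((fst z + 1) ^ S n * chi (snd z * (fst z + 1)) -
          (fst z - 1) ^ S n * chi (snd z * (fst z - 1))) -
     2 * ((fst z + 1) ^ n * chi1 (snd z * (fst z + 1)) +
          (fst z - 1) ^ n * chi1 (snd z * (fst z - 1)))).
  assert (Bd : forall q d, Rabs q < 1 -> Rabs d < e1 / 2 ->
     Rabs (d * (q + 1)) < e1 /\ Rabs (d * (q - 1)) < e1).
  { intros q d Hq Hd. apply Rabs_def2 in Hq.
    rewrite !Rabs_mult. pose proof (Rabs_pos d).
    assert (Rabs (q + 1) <= 2) by (apply Rabs_le; lra).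
    assert (Rabs (q - 1) <= 2) by (apply Rabs_le; lra).
    split; nra. }
  assert (EH : forall q d, Rabs q < 1 -> Rabs d < e1 / 2 ->
     trapezoid J (Derive J) (d * q + d) (d * q - d) = d ^ S n * H (q, d)).
  { intros q d Hq Hd. destruct (Bd q d Hq Hd) as [Bp Bm].
    replace (d * q + d) with (d * (q + 1)) by ring.
    replace (d * q - d) with (d * (q - 1)) by ring.
    unfold trapezoid. rewrite !EJ, !EJ1 by assumption.
    rewrite !Rminus_0_r, !Rpow_mult_distr. unfold H; simpl. ring. }
  set (DD := fun z : R * R => Rabs (fst z) < 1 /\ Rabs (snd z) < e1 / 2).
  assert (ODD : open (T := R2) DD).
  { apply (open_and (T := R2)).
    - apply (open_comp (T := R2) (U := R_UniformSpace) fst (ball0 1)); [|apply open_ball0].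
      intros z _. destruct z; apply (continuous_fst (U := R_UniformSpace) (V := R_UniformSpace)).
    - apply (open_comp (T := R2) (U := R_UniformSpace) snd (ball0 (e1 / 2))); [|apply open_ball0].
      intros z _. destruct z; apply (continuous_snd (U := R_UniformSpace) (V := R_UniformSpace)). }
  assert (Sf : smooth2 DD fst) by apply (smooth_linear (V := R2)), is_linear_fst.
  assert (Ss : smooth2 DD snd) by apply (smooth_linear (V := R2)), is_linear_snd.
  assert (Sp : smooth2 DD (fun z => fst z + 1)) by
    (apply (smooth_plus (V := R2)); [easy|apply smooth_const]).
  assert (Sm : smooth2 DD (fun z => fst z - 1)) by
    (apply (smooth_minus (V := R2)); [easy|apply smooth_const]).
  assert (Scp : forall c, smooth1 (ball0 e1) c -> smooth2 DD (fun z => c (snd z * (fst z + 1)))).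
  { intros c Sc. apply (smooth_comp (V := R2)) with (ball0 e1); [|easy|].
    - intros [q d] [Hq Hd]. now apply Bd.
    - now apply (smooth_mult (V := R2)). }
  assert (Scm : forall c, smooth1 (ball0 e1) c -> smooth2 DD (fun z => c (snd z * (fst z - 1)))).
  { intros c Sc. apply (smooth_comp (V := R2)) with (ball0 e1); [|easy|].
    - intros [q d] [Hq Hd]. now apply Bd.
    - now apply (smooth_mult (V := R2)). }
  assert (SH : smooth2 DD H).
  { apply (smooth_minus (V := R2)); apply (smooth_mult (V := R2)); try apply smooth_const.
    - apply (smooth_minus (V := R2)); apply (smooth_mult (V := R2)); auto;
        now apply (smooth_pow (V := R2)).
    - apply (smooth_plus (V := R2)); apply (smooth_mult (V := R2)); auto;
        now apply (smooth_pow (V := R2)). }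
  assert (HN : forall q, H (q, 0) = 2 * chi 0 * ((q + 1) ^ S n - (q - 1) ^ S n
                 - INR (S n) * ((q + 1) ^ n + (q - 1) ^ n))).
  { intros q. unfold H, chi1. cbn [fst snd]. rewrite !Rmult_0_l. ring. }
  assert (PE : (-1) ^ S n = 1 /\ (-1) ^ n = -1 /\ (-1) ^ pred n = 1).
  { replace (S n) with (2 * (m + 2))%nat by (unfold n; lia).
    replace (pred n) with (2 * (m + 1))%nat by (unfold n; lia).
    replace n with (S (2 * (m + 1)))%nat by (unfold n; lia).
    rewrite !pow_1_even, pow_1_odd. easy. }
  destruct PE as (PE1 & PE2 & PE3).
  assert (H00 : H (0, 0) = 0).
  { rewrite HN, Rplus_0_l, Rminus_0_l, !pow1. change (- (1)) with (-1). rewrite PE1, PE2. ring. }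
  set (l := 4 * chi 0 * INR (S n) * (1 - INR n)).
  assert (Hl : is_derive (fun q => H (q, 0)) 0 l).
  { apply (is_derive_ext (fun q => 2 * chi 0 * ((q + 1) ^ S n - (q - 1) ^ S n
                 - INR (S n) * ((q + 1) ^ n + (q - 1) ^ n)))).
    { intros q. now rewrite HN. }
    auto_derive; [easy|].
    change (match n with 0%nat => 1 | S _ => INR n + 1 end) with (INR (S n)). simpl pred.
    rewrite !Rplus_0_l, !pow1.
    change (- (1)) with (-1).
    rewrite PE2, PE3. unfold l. ring. }
  assert (Nl : l <> 0).
  { unfold l.
    assert (3 <= INR n).
    { replace 3 with (INR 3) by (simpl; ring). apply le_INR. unfold n; lia. }
    repeat apply Rmult_integral_contrapositive_currified; try easy; try lra.
    apply not_0_INR; discriminate. }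
  destruct (implicit_function DD H 0 0 l 1 ODD) as (r & e3 & q & Hr & e3pos & Sq & Hq & Uq);
    try easy; try lra.
  { split; simpl; rewrite Rabs_R0; lra. }
  assert (Sq' : smooth1 (ball0 e3) q).
  { apply (smooth_subset (V := R_NormedModule)) with (2 := Sq).
    intros x Hx. now rewrite Rminus_0_r. }
  assert (Hq' : forall d, Rabs d < e3 -> Rabs (q d) < r /\ H (q d, d) = 0).
  { intros d Hd. destruct (Hq d) as [A B]; [now rewrite Rminus_0_r|].
    rewrite Rminus_0_r in A. now split. }
  assert (q0 : q 0 = 0).
  { symmetry. apply Uq; [| |exact H00]; rewrite Rminus_0_r, Rabs_R0; lra. }
  set (eps := Rmin (e1 / 2) (e2 / 2)). set (e := Rmin e3 eps).
  assert (epspos : 0 < eps) by (apply Rmin_pos; lra).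
  assert (epsl : eps <= e1 / 2) by apply Rmin_l.
  assert (epsr : eps <= e2 / 2) by apply Rmin_r.
  assert (epos : 0 < e) by now apply Rmin_pos.
  assert (el : e <= e3) by apply Rmin_l.
  assert (er : e <= eps) by apply Rmin_r.
  assert (Zero : forall d, Rabs d < e ->
     Rabs (d * q d) < eps /\ trapezoid J (Derive J) (d * q d + d) (d * q d - d) = 0).
  { intros d Hd. destruct (Hq' d) as [A B]; [lra|]. split.
    - rewrite Rabs_mult. pose proof (Rabs_pos d). pose proof (Rabs_pos (q d)). nra.
    - rewrite EH by lra. rewrite B. ring. }
  exists eps, e, (fun d => d * q d).
  split; [easy|]. split; [easy|]. split; [lra|]. split; [|split; [|split; [|split]]].
  - apply (smooth_mult (V := R_NormedModule)); [apply smooth1_id|].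
    apply (smooth_subset (V := R_NormedModule)) with (2 := Sq').
    intros x Hx. unfold ball0 in *. lra.
  - ring.
  - assert (H3 : ball0 e3 0) by (unfold ball0; rewrite Rabs_R0; lra).
    pose proof (smooth1_is_derive _ q 0 (open_ball0 e3) Sq' H3) as Dq.
    auto_derive; [eexists; exact Dq|]. rewrite q0. ring.
  - exact Zero.
  - intros x d Hx Hd Nd E.
    destruct (Zero d Hd) as [Hp Ep].
    (* Two zeros on one line of fixed difference would contradict Rolle. *)
    assert (Shear : forall x y, Rabs x < eps -> Rabs y < eps -> x < y ->
      trapezoid J (Derive J) (x + d) (x - d) = 0 -> trapezoid J (Derive J) (y + d) (y - d) = 0 -> False).
    { clear x Hx E. intros x y Hx Hy Hxy Ex Ey.
      apply Rabs_def2 in Hx, Hy. pose proof Hd as Hd'. apply Rabs_def2 in Hd'.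
      destruct (MVT_strict (fun x => trapezoid J (Derive J) (x + d) (x - d))
        (fun x => trapezoid (Derive J) (Derive (Derive J)) (x + d) (x - d)) x y Hxy) as (z & Hz & Ez).
      - intros z Hz. apply trapezoid_shear_derive with e1; [easy| |]; apply Rabs_def1; lra.
      - rewrite Ex, Ey in Ez.
        apply (trapezoid_nonzero (Derive J) (Derive (Derive J)) (Derive (Derive (Derive J))) e2
          (z + d) (z - d)); try easy.
        + intros t Ht. apply (smooth1_is_derive (ball0 e1)); auto.
        + intros t Ht. apply (smooth1_is_derive (ball0 e1)); auto.
        + apply Rabs_def1; lra.
        + apply Rabs_def1; lra.
        + lra.
        + apply Rmult_eq_reg_r with (y - x); lra. }
    destruct (Rtotal_order x (d * q d)) as [L|[L|L]]; [|easy|]; exfalso.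
    + now apply (Shear x (d * q d)).
    + now apply (Shear (d * q d) x).
Qed.

(** * The support function as a function of the half-angle tangent *)

Definition near (s0 e s : R) : Prop := Rabs (s - s0) < e.

Lemma open_near s0 e : open (near s0 e).
Proof.
  intros s Hs. unfold near in *.
  assert (P : 0 < e - Rabs (s - s0)) by lra. exists (mkposreal _ P). intros t Ht.
  change (Rabs (t - s) < e - Rabs (s - s0)) in Ht.
  replace (t - s0) with ((t - s) + (s - s0)) by ring.
  pose proof (Rabs_triang (t - s) (s - s0)). lra.
Qed.

Lemma near_center s0 e : 0 < e -> near s0 e s0.
Proof. intros He. unfold near. now rewrite Rminus_diag, Rabs_R0. Qed.

Lemma starlike_near s0 e : starlike (near s0 e) s0.
Proof.
  intros x t Hx Ht. unfold near in *.
  replace (s0 + (x - s0) * t - s0) with ((x - s0) * t) by ring.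
  rewrite Rabs_mult, (Rabs_pos_eq t) by lra. pose proof (Rabs_pos (x - s0)). nra.
Qed.

Lemma norm_R2 (p : R * R) : norm p = sqrt (fst p ^ 2 + snd p ^ 2).
Proof.
  unfold norm; simpl; unfold prod_norm, norm; simpl; unfold abs; simpl.
  rewrite !Rmult_1_r, <- !Rabs_mult, !(Rabs_pos_eq (_ * _)); try easy;
    apply Rle_0_sqr.
Qed.

(** In the frame of the tangent at [s0] with origin [c], let [u] be the tangent of
    half the turning angle and [j = (1 + u^2) (h - rho)], where [h] is the support
    function of the curve and [rho = h(s0)] is the radius up to sign. Then
    [l = dj/du], and a direct computation turns [presym_fun] into the trapezoid
    defect of [j] with respect to [u]. The derivative of [j / (1 + u^2)] is a
    nonvanishing multiple of that of the contact function, which gives the order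
    of [j]. *)
Lemma laguerre_chart a b gamma k s0 c r :
  smooth_regular a b gamma -> in_itv a b s0 -> (3 <= k)%nat ->
  has_A_contact gamma c r k s0 ->
  exists (eta : R) (u j l : R -> R), 0 < eta /\
    (forall s, near s0 eta s -> in_itv a b s) /\
    smooth1 (near s0 eta) u /\ u s0 = 0 /\ Derive u s0 <> 0 /\
    smooth1 (near s0 eta) j /\ has_order (near s0 eta) s0 (S k) j /\
    (forall s, near s0 eta s -> Derive j s = Derive u s * l s) /\
    (forall s t, near s0 eta s -> near s0 eta t ->
      presym_fun gamma s t = (u s - u t) / ((1 + u s ^ 2) * (1 + u t ^ 2)) *
        (2 * (j s - j t) - (u s - u t) * (l s + l t))).
Proof.
  intros (Sx & Sy & Reg) Hs0 Hk (_ & C0 & C1).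
  apply smooth_on_iff in Sx, Sy.
  set (x := fun u => fst (gamma u)) in *. set (y := fun u => snd (gamma u)) in *.
  pose proof (open_itv a b) as OD.
  set (v0 := sqrt (Derive x s0 ^ 2 + Derive y s0 ^ 2)).
  assert (Vpos : forall s, in_itv a b s -> 0 < Derive x s ^ 2 + Derive y s ^ 2).
  { intros s Hs. specialize (Reg s Hs). unfold velocity in Reg. fold x y in Reg.
    destruct (Req_dec (Derive x s) 0) as [Ex|Nx]; [destruct (Req_dec (Derive y s) 0) as [Ey|Ny]|].
    - exfalso. apply Reg. now rewrite Ex, Ey.
    - assert (0 < Derive y s ^ 2) by nra. nra.
    - assert (0 < Derive x s ^ 2) by nra. nra. }
  assert (v0pos : 0 < v0) by now apply sqrt_lt_R0, Vpos.
  assert (v0sq : v0 ^ 2 = Derive x s0 ^ 2 + Derive y s0 ^ 2).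
  { unfold v0. rewrite <- Rsqr_pow2, Rsqr_sqrt; [easy|]. now apply Rlt_le, Vpos. }
  set (t1 := Derive x s0 / v0). set (t2 := Derive y s0 / v0).
  assert (Et : t1 ^ 2 + t2 ^ 2 = 1).
  { unfold t1, t2. replace (_ + _) with ((Derive x s0 ^ 2 + Derive y s0 ^ 2) / v0 ^ 2)
      by (field; lra). rewrite <- v0sq. field. lra. }
  set (X := fun s => (x s - fst c) * t1 + (y s - snd c) * t2).
  set (Y := fun s => (y s - snd c) * t1 - (x s - fst c) * t2).
  assert (SX : smooth1 (in_itv a b) X).
  { apply (smooth_plus (V := R_NormedModule)); apply (smooth_mult (V := R_NormedModule));
      try apply smooth_const; apply (smooth_minus (V := R_NormedModule)); try easy; apply smooth_const. }
  assert (SY : smooth1 (in_itv a b) Y).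
  { apply (smooth_minus (V := R_NormedModule)); apply (smooth_mult (V := R_NormedModule));
      try apply smooth_const; apply (smooth_minus (V := R_NormedModule)); try easy; apply smooth_const. }
  assert (DX : forall s, in_itv a b s -> Derive X s = Derive x s * t1 + Derive y s * t2).
  { intros s Hs. apply is_derive_unique.
    pose proof (smooth1_is_derive _ _ _ OD Sx Hs) as D1.
    pose proof (smooth1_is_derive _ _ _ OD Sy Hs) as D2.
    unfold X. auto_derive; [split; [eexists; exact D1|split; [eexists; exact D2|easy]]|].
    change (fun x0 => x x0) with x. change (fun x0 => y x0) with y. ring. }
  assert (DY : forall s, in_itv a b s -> Derive Y s = Derive y s * t1 - Derive x s * t2).
  { intros s Hs. apply is_derive_unique.
    pose proof (smooth1_is_derive _ _ _ OD Sx Hs) as D1.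
    pose proof (smooth1_is_derive _ _ _ OD Sy Hs) as D2.
    unfold Y. auto_derive; [split; [eexists; exact D2|split; [eexists; exact D1|easy]]|].
    change (fun x0 => x x0) with x. change (fun x0 => y x0) with y. ring. }
  assert (X1s0 : Derive X s0 = v0).
  { rewrite DX by easy. unfold t1, t2.
    replace (_ + _) with ((Derive x s0 ^ 2 + Derive y s0 ^ 2) / v0) by (field; lra).
    rewrite <- v0sq. field. lra. }
  assert (Y1s0 : Derive Y s0 = 0).
  { rewrite DY by easy. unfold t1, t2. field. lra. }
  set (X1 := Derive X) in *. set (Y1 := Derive Y) in *.
  assert (SX1 : smooth1 (in_itv a b) X1) by now apply smooth1_Derive.
  assert (SY1 : smooth1 (in_itv a b) Y1) by now apply smooth1_Derive.
  assert (V1 : forall s, in_itv a b s -> X1 s ^ 2 + Y1 s ^ 2 = Derive x s ^ 2 + Derive y s ^ 2).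
  { intros s Hs. rewrite DX, DY by easy.
    replace (_ + _) with ((Derive x s ^ 2 + Derive y s ^ 2) * (t1 ^ 2 + t2 ^ 2)) by ring.
    rewrite Et. ring. }
  (* On this neighbourhood the tangent turns by less than a right angle. *)
  assert (Nb : exists eta, 0 < eta /\ forall s, near s0 eta s -> in_itv a b s /\ 0 < X1 s).
  { assert (F : locally s0 (fun s => in_itv a b s /\ 0 < X1 s)).
    { apply filter_and; [now apply OD|].
      apply (smooth_continuous (V := R_NormedModule) _ X1 s0 SX1 Hs0 (fun t => 0 < t)).
      apply open_gt. rewrite X1s0. exact v0pos. }
    destruct F as [eta He]. exists eta. split; [apply cond_pos|]. intros s Hs. now apply He. }
  destruct Nb as (eta & etapos & Nb).
  pose (I := near s0 eta).
  assert (OI : open I) by apply open_near.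
  assert (Is0 : I s0) by now apply near_center.
  assert (SI : forall f, smooth1 (in_itv a b) f -> smooth1 I f).
  { intros f. apply (smooth_subset (V := R_NormedModule)). intros s Hs. now apply Nb. }
  apply SI in Sx, Sy, SX, SY, SX1, SY1.
  set (v := fun s => sqrt (X1 s ^ 2 + Y1 s ^ 2)).
  assert (Vp : forall s, I s -> 0 < v s).
  { intros s Hs. apply sqrt_lt_R0. rewrite V1 by now apply Nb. now apply Vpos, Nb. }
  assert (Vsq : forall s, I s -> v s ^ 2 = X1 s ^ 2 + Y1 s ^ 2).
  { intros s Hs. unfold v. rewrite <- (Rsqr_pow2 (sqrt _)), Rsqr_sqrt; [easy|].
    rewrite V1 by now apply Nb. now apply Rlt_le, Vpos, Nb. }
  assert (VX : forall s, I s -> 0 < v s + X1 s).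
  { intros s Hs. pose proof (Vp s Hs). destruct (Nb s Hs). lra. }
  assert (Sv : smooth1 I v).
  { apply (smooth_comp (V := R_NormedModule) I (fun t => 0 < t) sqrt (fun s => X1 s ^ 2 + Y1 s ^ 2)).
    - intros s Hs. cbv beta. rewrite V1 by now apply Nb. now apply Vpos, Nb.
    - apply smooth1_sqrt.
    - apply (smooth_plus (V := R_NormedModule)); now apply (smooth_pow (V := R_NormedModule)). }
  set (u := fun s => Y1 s / (v s + X1 s)).
  assert (Su : smooth1 I u).
  { apply (smooth_div (V := R_NormedModule)); [|easy|now apply (smooth_plus (V := R_NormedModule))].
    intros s Hs. now apply Rgt_not_eq, VX. }
  assert (Eu : forall s, I s -> Y1 s = u s * (v s + X1 s)).
  { intros s Hs. pose proof (VX s Hs). unfold u. field. lra. }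
  assert (us0 : u s0 = 0) by (unfold u; rewrite Y1s0; unfold Rdiv; ring).
  clearbody u.
  assert (U1 : forall s, I s -> X1 s = v s * (1 - u s ^ 2) / (1 + u s ^ 2)).
  { intros s Hs. pose proof (VX s Hs). pose proof (Vp s Hs). pose proof (Vsq s Hs) as E.
    assert (1 + u s ^ 2 <> 0) by (pose proof (pow2_ge_0 (u s)); lra).
    rewrite (Eu s Hs) in E.
    assert (F : v s - X1 s = u s ^ 2 * (v s + X1 s)).
    { apply Rmult_eq_reg_r with (v s + X1 s); [|lra].
      transitivity (v s ^ 2 - X1 s ^ 2); [ring|]. rewrite E. ring. }
    apply Rmult_eq_reg_r with (1 + u s ^ 2); [|easy].
    transitivity (v s * (1 - u s ^ 2)); [|field; easy].
    replace (X1 s * (1 + u s ^ 2)) with (u s ^ 2 * (v s + X1 s) + X1 s - v s * u s ^ 2) by ring.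
    rewrite <- F. ring. }
  assert (U2 : forall s, I s -> Y1 s = v s * (2 * u s) / (1 + u s ^ 2)).
  { intros s Hs. pose proof (VX s Hs).
    assert (1 + u s ^ 2 <> 0) by (pose proof (pow2_ge_0 (u s)); lra).
    rewrite (Eu s Hs), (U1 s Hs). field. easy. }
  set (rho := Y s0).
  set (l := fun s => - 2 * (X s + u s * (Y s + rho))).
  set (j := fun s => - 2 * u s * X s + (1 - u s ^ 2) * Y s - rho * (1 + u s ^ 2)).
  assert (SB : smooth1 I (fun s => 1 + u s ^ 2)).
  { apply (smooth_plus (V := R_NormedModule)); [apply smooth_const|now apply (smooth_pow (V := R_NormedModule))]. }
  assert (Bpos : forall s, 1 + u s ^ 2 <> 0) by (intros s; pose proof (pow2_ge_0 (u s)); lra).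
  assert (Sj : smooth1 I j).
  { apply (smooth_minus (V := R_NormedModule)).
    - apply (smooth_plus (V := R_NormedModule)); repeat apply (smooth_mult (V := R_NormedModule)); try easy.
      + apply smooth_const.
      + apply (smooth_minus (V := R_NormedModule)); [apply smooth_const|now apply (smooth_pow (V := R_NormedModule))].
    - apply (smooth_mult (V := R_NormedModule)); [apply smooth_const|easy]. }
  assert (Dj : forall s, I s -> Derive j s = Derive u s * l s).
  { intros s Hs. apply is_derive_unique.
    pose proof (smooth1_is_derive _ _ _ OI SX Hs) as D1. fold X1 in D1.
    pose proof (smooth1_is_derive _ _ _ OI SY Hs) as D2. fold Y1 in D2.
    pose proof (smooth1_is_derive _ _ _ OI Su Hs) as D3.
    pose proof (U1 s Hs) as E1. pose proof (U2 s Hs) as E2.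
    clearbody X Y X1 Y1.
    unfold j. auto_derive; [repeat split; try (eexists; eassumption)|].
    change (fun x0 => X x0) with X. change (fun x0 => Y x0) with Y. change (fun x0 => u x0) with u.
    rewrite (is_derive_unique _ _ _ D1), (is_derive_unique _ _ _ D2), E1, E2.
    unfold l. field. apply Bpos. }
  set (Ct := circle_contact gamma c r) in *.
  assert (ECt : forall s, Ct s = X s ^ 2 + Y s ^ 2 - r ^ 2).
  { intros s. unfold Ct, circle_contact. rewrite norm_R2, <- (Rsqr_pow2 (sqrt _)), Rsqr_sqrt.
    - unfold minus, plus, opp; simpl. unfold plus, opp; simpl. fold (x s) (y s).
      unfold X, Y.
      transitivity (((x s - fst c) ^ 2 + (y s - snd c) ^ 2) * (t1 ^ 2 + t2 ^ 2) - r ^ 2); [|ring].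
      rewrite Et. ring.
    - apply Rplus_le_le_0_compat; apply pow2_ge_0. }
  assert (SCt : smooth1 I Ct).
  { apply (smooth_ext (V := R_NormedModule)) with (fun s => X s ^ 2 + Y s ^ 2 - r ^ 2); [easy|now intros; rewrite ECt|].
    apply (smooth_minus (V := R_NormedModule)); [|apply smooth_const].
    apply (smooth_plus (V := R_NormedModule)); now apply (smooth_pow (V := R_NormedModule)). }
  assert (DCt : forall s, I s -> Derive Ct s = 2 * (X s * X1 s + Y s * Y1 s)).
  { intros s Hs. rewrite (Derive_ext _ _ s ECt). apply is_derive_unique.
    pose proof (smooth1_is_derive _ _ _ OI SX Hs) as D1. fold X1 in D1.
    pose proof (smooth1_is_derive _ _ _ OI SY Hs) as D2. fold Y1 in D2.
    clearbody X Y X1 Y1.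
    auto_derive; [repeat split; try (eexists; eassumption)|].
    change (fun x0 => X x0) with X. change (fun x0 => Y x0) with Y.
    rewrite (is_derive_unique _ _ _ D1), (is_derive_unique _ _ _ D2). ring. }
  assert (OCt : has_order I s0 k (Derive Ct)).
  { assert (HS : forall i, Derive_n (Derive Ct) i s0 = Derive_n Ct (S i) s0).
    { intros i. rewrite <- Nat.add_1_r. apply (Derive_n_comp Ct i 1). }
    apply order_of_derivatives; try easy.
    - apply starlike_near.
    - now apply smooth1_Derive.
    - intros i Hi. rewrite HS. apply C0. lia.
    - now rewrite HS. }
  (* At s0 the radius vector is normal, so the vanishing second derivative of the
     contact function forces a nonzero curvature. *)
  assert (Du : Derive u s0 <> 0).
  { assert (E1 : Derive Ct s0 = 0) by (apply (C0 1%nat); lia).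
    assert (E2 : Derive (Derive Ct) s0 = 0) by (apply (C0 2%nat); lia).
    rewrite DCt, X1s0, Y1s0 in E1 by easy.
    assert (X0 : X s0 = 0) by (apply Rmult_eq_reg_r with (2 * v0); lra).
    pose proof (smooth1_is_derive _ _ _ OI SX Is0) as D1. fold X1 in D1.
    pose proof (smooth1_is_derive _ _ _ OI SY Is0) as D2. fold Y1 in D2.
    pose proof (smooth1_is_derive _ _ _ OI SX1 Is0) as D3.
    pose proof (smooth1_is_derive _ _ _ OI SY1 Is0) as D4.
    pose proof (smooth1_is_derive _ _ _ OI Su Is0) as D5.
    pose proof (smooth1_is_derive _ _ _ OI Sv Is0) as D6.
    assert (E3 : Derive (Derive Ct) s0 = 2 * (v0 ^ 2 + Y s0 * Derive Y1 s0)).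
    { rewrite (Derive_ext_loc _ (fun s => 2 * (X s * X1 s + Y s * Y1 s))).
      2:{ apply filter_imp with (2 := OI s0 Is0). exact DCt. }
      apply is_derive_unique. clearbody X Y X1 Y1.
      auto_derive; [repeat split; try (eexists; eassumption)|].
      change (fun x0 => X x0) with X. change (fun x0 => Y x0) with Y.
      change (fun x0 => X1 x0) with X1. change (fun x0 => Y1 x0) with Y1.
      rewrite (is_derive_unique _ _ _ D1), (is_derive_unique _ _ _ D2), X0, X1s0, Y1s0. ring. }
    assert (E4 : Derive Y1 s0 = Derive u s0 * (v s0 + X1 s0)).
    { rewrite (Derive_ext_loc Y1 (fun s => u s * (v s + X1 s))).
      2:{ apply filter_imp with (2 := OI s0 Is0). exact Eu. }
      apply is_derive_unique. clearbody v X1.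
      auto_derive; [repeat split; try (eexists; eassumption)|].
      change (fun x0 => u x0) with u. rewrite us0. ring. }
    intros E5. rewrite E4, E5 in E3. rewrite E2 in E3. nra. }
  assert (Oj : has_order I s0 (S k) j).
  { apply order_ext with (fun s => j s / (1 + u s ^ 2) * (1 + u s ^ 2)).
    { intros s Hs. field. apply Bpos. }
    apply order_mul; [easy|apply Bpos|].
    apply order_primitive; try easy.
    - apply starlike_near.
    - apply (smooth_div (V := R_NormedModule)); [|easy|easy]. intros s _. apply Bpos.
    - unfold j. rewrite us0. unfold rho. field.
    - apply order_ext with (fun s => Derive Ct s * (- (Derive u s / ((1 + u s ^ 2) * v s)))).
      + intros s Hs. symmetry. apply is_derive_unique.
        pose proof (smooth1_is_derive _ _ _ OI Sj Hs) as D1.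
        pose proof (smooth1_is_derive _ _ _ OI Su Hs) as D2.
        rewrite (DCt s Hs), (U1 s Hs), (U2 s Hs). specialize (Dj s Hs). pose proof (Vp s Hs).
        assert (Ej : j s = - 2 * u s * X s + (1 - u s ^ 2) * Y s - rho * (1 + u s ^ 2)) by reflexivity.
        assert (El : l s = - 2 * (X s + u s * (Y s + rho))) by reflexivity.
        rewrite El in Dj.
        clearbody j.
        auto_derive; [repeat split; try (eexists; eassumption)|].
        { pose proof (pow2_ge_0 (u s)). lra. }
        change (fun x0 => j x0) with j. change (fun x0 => u x0) with u.
        rewrite Dj, Ej. field. split; [lra|apply Bpos].
      + apply order_mul; [| |easy].
        * apply (smooth_opp (V := R_NormedModule)), (smooth_div (V := R_NormedModule)).
          -- intros s Hs. apply Rmult_integral_contrapositive_currified; [apply Bpos|].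
             now apply Rgt_not_eq, Vp.
          -- now apply smooth1_Derive.
          -- now apply (smooth_mult (V := R_NormedModule)).
        * pose proof (Vp s0 Is0). apply Ropp_neq_0_compat.
          apply Rmult_integral_contrapositive_currified; [easy|].
          apply Rinv_neq_0_compat, Rmult_integral_contrapositive_currified; [apply Bpos|lra]. }
  exists eta, u, j, l. split; [easy|]. split; [intros s Hs; now apply Nb|].
  do 6 (split; [easy|]).
  intros s t Hs Ht.
  assert (EN : forall s, I s -> norm (velocity gamma s) = v s).
  { intros z Hz. rewrite norm_R2. unfold v. rewrite V1 by now apply Nb. reflexivity. }
  (* The inner product is computed in the rotated frame. *)
  transitivity ((X s - X t) * (X1 s / v s - X1 t / v t) + (Y s - Y t) * (Y1 s / v s - Y1 t / v t)).
  - rewrite !DX, !DY by now apply Nb.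
    unfold presym_fun, unit_tangent, dot. rewrite !EN by easy.
    unfold velocity. fold x y.
    unfold minus, plus, opp, scal; simpl. unfold plus, opp, scal; simpl. unfold mult; simpl.
    fold (x s) (y s) (x t) (y t). unfold X, Y.
    transitivity (((x s - x t) * (/ v s * Derive x s - / v t * Derive x t) +
      (y s - y t) * (/ v s * Derive y s - / v t * Derive y t)) * (t1 ^ 2 + t2 ^ 2)).
    + rewrite Et. ring.
    + unfold Rdiv. ring.
  - rewrite (U1 s Hs), (U2 s Hs), (U1 t Ht), (U2 t Ht). unfold j, l.
    pose proof (Vp s Hs). pose proof (Vp t Ht).
    field. repeat split; try apply Bpos; lra.
Qed.

(** * The set in the half-angle coordinate *)

Lemma inverse_function (u : R -> R) s0 eta : 0 < eta ->
  smooth1 (near s0 eta) u -> u s0 = 0 -> Derive u s0 <> 0 ->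
  exists r e ui, 0 < r <= eta /\ 0 < e /\ smooth1 (ball0 e) ui /\
    (forall x, Rabs x < e -> near s0 r (ui x) /\ u (ui x) = x) /\
    (forall s, near s0 r s -> Rabs (u s) < e -> ui (u s) = s).
Proof.
  intros He Su u0 Nu.
  pose (D := fun z : R * R => near s0 eta (fst z)).
  assert (OD : open (T := R2) D).
  { apply (open_comp (T := R2) (U := R_UniformSpace) fst (near s0 eta)); [|apply open_near].
    intros z _. destruct z; apply (continuous_fst (U := R_UniformSpace) (V := R_UniformSpace)). }
  destruct (implicit_function D (fun z => u (fst z) - snd z) s0 0 (Derive u s0) eta OD)
    as (r & e & ui & Hr & epos & SS & HS & US); try easy.
  - now apply near_center.
  - apply (smooth_minus (V := R2)).
    + apply (smooth_comp (V := R2) D (near s0 eta) u fst); try easy.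
      apply (smooth_linear (V := R2)), is_linear_fst.
    + apply (smooth_linear (V := R2)), is_linear_snd.
  - simpl. rewrite u0. ring.
  - pose proof (smooth1_is_derive _ _ _ (open_near s0 eta) Su (near_center _ _ He)) as D1.
    simpl. auto_derive; [eexists; exact D1|]. change (fun x => u x) with u. ring.
  - exists r, e, ui. split; [easy|split; [easy|split; [|split]]].
    + apply (smooth_subset (V := R_NormedModule)) with (2 := SS).
      intros x Hx. now rewrite Rminus_0_r.
    + intros x Hx. destruct (HS x) as [A B]; [now rewrite Rminus_0_r|].
      simpl in B. split; [exact A|lra].
    + intros s Hs Hu. symmetry. apply US; [exact Hs|now rewrite Rminus_0_r|simpl; ring].
Qed.

Lemma trapezoid_error_ne (f f1 f2 f3 : R -> R) (e a b : R) : a <> b ->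
  Rabs a < e -> Rabs b < e ->
  (forall x, Rabs x < e -> is_derive f x (f1 x)) ->
  (forall x, Rabs x < e -> is_derive f1 x (f2 x)) ->
  (forall x, Rabs x < e -> is_derive f2 x (f3 x)) ->
  exists zeta, Rmin a b <= zeta <= Rmax a b /\ trapezoid f f1 a b = - f3 zeta / 6 * (a - b) ^ 3.
Proof.
  intros Nab Ha Hb H1 H2 H3. apply Rabs_def2 in Ha, Hb.
  destruct (Rtotal_order a b) as [L|[L|L]]; [|easy|].
  - destruct (trapezoid_error f f1 f2 f3 b a L) as (z & Hz & Ez).
    + intros x Hx. apply H1, Rabs_def1; lra.
    + intros x Hx. apply H2, Rabs_def1; lra.
    + intros x Hx. apply H3, Rabs_def1; lra.
    + exists z. rewrite Rmin_left, Rmax_right by lra. split; [lra|].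
      transitivity (- trapezoid f f1 b a); [unfold trapezoid; ring|]. rewrite Ez. field.
  - destruct (trapezoid_error f f1 f2 f3 a b L) as (z & Hz & Ez).
    + intros x Hx. apply H1, Rabs_def1; lra.
    + intros x Hx. apply H2, Rabs_def1; lra.
    + intros x Hx. apply H3, Rabs_def1; lra.
    + exists z. rewrite Rmin_right, Rmax_left by lra. split; [lra|easy].
Qed.

Lemma is_lim_mult_finite (f g : R -> R) (x lf lg : R) :
  is_lim f x lf -> is_lim g x lg -> is_lim (fun y => f y * g y) x (lf * lg).
Proof. intros Hf Hg. exact (is_lim_mult f g x lf lg Hf Hg I). Qed.

(** Divide the defect by [(t - s)^3] and let [t] tend to [s]: by the error term of
    the trapezoid rule, [g s] is a nonzero multiple of [J''' (u s)]. *)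
Lemma diagonal_value (g u J : R -> R) e s du :
  smooth1 (ball0 e) J -> is_derive u s du -> du <> 0 -> Rabs (u s) < e ->
  continuous g s ->
  locally s (fun t => t <> s -> u t <> u s /\
    (t - s) ^ 4 * g t = (u t - u s) / ((1 + u t ^ 2) * (1 + u s ^ 2)) *
      trapezoid J (Derive J) (u t) (u s)) ->
  (g s = 0 <-> Derive (Derive (Derive J)) (u s) = 0).
Proof.
  intros SJ Du Ndu Hus Cg Loc.
  pose proof (open_ball0 e) as OD.
  pose proof (smooth1_Derive _ _ OD SJ) as S1.
  pose proof (smooth1_Derive _ _ OD S1) as S2.
  pose proof (smooth1_Derive _ _ OD S2) as S3.
  set (J3 := Derive (Derive (Derive J))) in *.
  assert (Cu : continuous u s) by (apply (ex_derive_continuous (V := R_NormedModule)); now exists du).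
  assert (Bp : forall y, 1 + y ^ 2 <> 0) by (intros y; pose proof (pow2_ge_0 y); lra).
  set (Q := fun t => (u t - u s) / (t - s)).
  set (T := fun t => - 6 * trapezoid J (Derive J) (u t) (u s) / (u t - u s) ^ 3).
  assert (LQ : is_lim Q s du).
  { apply is_lim_spec. intros eps.
    apply is_derive_Reals in Du. destruct (Du eps (cond_pos eps)) as [del Hdel].
    exists del. intros t Ht Nt. change (Rabs (t - s) < del) in Ht.
    specialize (Hdel (t - s) (Rminus_eq_contra _ _ Nt) Ht).
    unfold Q. now rewrite Rplus_minus in Hdel. }
  assert (LT : is_lim T s (J3 (u s))).
  { apply is_lim_spec. intros eps.
    assert (C3 : continuous J3 (u s)) by now apply (smooth_continuous (V := R_NormedModule) (ball0 e)).
    assert (B : locally (J3 (u s)) (fun y => Rabs (y - J3 (u s)) < eps)) by now exists eps.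
    destruct (C3 _ B) as [del Hdel].
    assert (F : locally s (fun t => (Rabs (u t - u s) < del /\ Rabs (u t) < e) /\ (t <> s -> u t <> u s))).
    { apply filter_and; [apply filter_and|].
      - apply (Cu (fun y => Rabs (y - u s) < del)). now exists del.
      - apply (Cu (ball0 e)). now apply OD.
      - apply filter_imp with (2 := Loc). intros t Ht Nt. now apply Ht. }
    apply filter_imp with (2 := F). intros t [[Ht Het] Nt'] Nt. specialize (Nt' Nt).
    destruct (trapezoid_error_ne J (Derive J) (Derive (Derive J)) J3 e (u t) (u s)) as (z & Hz & Ez);
      try easy; try (intros x Hx; now apply (smooth1_is_derive (ball0 e))).
    unfold T. rewrite Ez.
    replace (-6 * (- J3 z / 6 * (u t - u s) ^ 3) / (u t - u s) ^ 3) with (J3 z).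
    2:{ field. lra. }
    apply Hdel. change (Rabs (z - u s) < del).
    apply (between_ball (u t) (u s)); try easy. rewrite Rminus_diag, Rabs_R0. apply cond_pos. }
  assert (Lg : is_lim g s (g s)).
  { apply is_lim_continuity. now apply continuity_pt_filterlim. }
  set (K := fun t => 6 * ((1 + u t ^ 2) * (1 + u s ^ 2))).
  assert (LK : is_lim K s (K s)).
  { apply is_lim_continuity, continuity_pt_filterlim.
    apply (ex_derive_continuous (V := R_NormedModule)). unfold K.
    auto_derive. now exists du. }
  assert (L1 : is_lim (fun t => g t * K t) s (g s * K s)) by now apply is_lim_mult_finite.
  assert (L2 : is_lim (fun t => - (Q t * Q t * (Q t * Q t) * T t)) s (- (du * du * (du * du) * J3 (u s)))).
  { apply (is_lim_opp (fun t => Q t * Q t * (Q t * Q t) * T t) s (du * du * (du * du) * J3 (u s))).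
    apply is_lim_mult_finite; [|exact LT].
    apply is_lim_mult_finite; apply is_lim_mult_finite; exact LQ. }
  assert (E : g s * K s = - (du * du * (du * du) * J3 (u s))).
  { apply is_lim_unique in L2.
    enough (L3 : is_lim (fun t => - (Q t * Q t * (Q t * Q t) * T t)) s (g s * K s)).
    { apply is_lim_unique in L3. rewrite L2 in L3. now injection L3. }
    apply is_lim_ext_loc with (2 := L1).
    apply filter_imp with (2 := Loc). intros t Ht Nt. destruct (Ht Nt) as [Nu Eg].
    assert (t - s <> 0) by lra. assert (u t - u s <> 0) by lra.
    apply Rmult_eq_reg_l with ((t - s) ^ 4); [|now apply pow_nonzero].
    rewrite <- Rmult_assoc, Eg. unfold K, Q, T. field. repeat split; try easy; apply Bp. }
  assert (KN : K s <> 0).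
  { unfold K. apply Rmult_integral_contrapositive_currified; [lra|].
    apply Rmult_integral_contrapositive_currified; apply Bp. }
  assert (dN : du * du * (du * du) <> 0) by now repeat apply Rmult_integral_contrapositive_currified.
  split; intros Z; rewrite Z in E.
  - apply Rmult_eq_reg_l with (du * du * (du * du)); lra.
  - apply Rmult_eq_reg_r with (K s); lra.
Qed.

(** The chart read in the coordinate [u], with inverse [ui]: off the diagonal the
    set is the zero set of the trapezoid defect of [J], on the diagonal it is
    reduced to the centre. *)
Lemma local_model a b gamma gt k s0 c r :
  smooth_regular a b gamma -> presym_quotient a b gamma gt -> in_itv a b s0 ->
  (3 <= k)%nat -> has_A_contact gamma c r k s0 ->
  exists (rr e : R) (u ui J : R -> R), 0 < rr /\ 0 < e /\ u s0 = 0 /\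
    smooth1 (ball0 e) ui /\ smooth1 (ball0 e) J /\ has_order (ball0 e) 0 (1 + k) J /\
    (forall s, near s0 rr s -> in_itv a b s /\ continuous u s) /\
    (forall x, Rabs x < e -> near s0 rr (ui x) /\ u (ui x) = x /\ Derive ui x <> 0) /\
    (forall s, near s0 rr s -> Rabs (u s) < e -> ui (u s) = s) /\
    (forall s t, near s0 rr s -> Rabs (u s) < e -> near s0 rr t -> Rabs (u t) < e ->
       s <> t -> (gt s t = 0 <-> trapezoid J (Derive J) (u s) (u t) = 0)) /\
    (forall s, near s0 rr s -> Rabs (u s) < e -> (gt s s = 0 <-> u s = 0)).
Proof.
  intros Hg (Sgt & Egt) Hs0 Hk HA.
  destruct (laguerre_chart a b gamma k s0 c r Hg Hs0 Hk HA)
    as (eta & u & j & l & He & Hin & Su & u0 & Nu & Sj & Oj & Dj & Epre).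
  destruct (inverse_function u s0 eta He Su u0 Nu) as (rr & e & ui & Hrr & epos & SS & HS & US).
  assert (Sub : forall s, near s0 rr s -> near s0 eta s) by (unfold near; intros; lra).
  pose proof (open_near s0 eta) as ON. pose proof (open_ball0 e) as OB.
  set (J := fun x => j (ui x)).
  assert (S0 : ui 0 = s0).
  { rewrite <- u0. apply US; [apply near_center; lra|]. now rewrite u0, Rabs_R0. }
  assert (H0 : ball0 e 0) by (unfold ball0; now rewrite Rabs_R0).
  assert (SJ : smooth1 (ball0 e) J).
  { apply (smooth_comp (V := R_NormedModule) (ball0 e) (near s0 eta) j ui); try easy.
    intros x Hx. now apply Sub, HS. }
  assert (DS : forall x, Rabs x < e -> Derive u (ui x) * Derive ui x = 1).
  { intros x Hx.
    pose proof (smooth1_is_derive _ _ _ OB SS Hx) as D1.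
    pose proof (smooth1_is_derive _ _ _ ON Su (Sub _ (proj1 (HS x Hx)))) as D2.
    assert (D3 : is_derive (fun y => u (ui y)) x (Derive ui x * Derive u (ui x)))
      by exact (is_derive_comp u ui x _ _ D2 D1).
    assert (D4 : is_derive (fun y => u (ui y)) x 1).
    { apply (is_derive_ext_loc (fun y => y)).
      - apply filter_imp with (2 := OB x Hx). intros y Hy. symmetry. now apply HS.
      - apply (is_derive_id (K := R_AbsRing)). }
    apply is_derive_unique in D3. apply is_derive_unique in D4. lra. }
  assert (NS : forall x, Rabs x < e -> Derive ui x <> 0).
  { intros x Hx E. specialize (DS x Hx). rewrite E in DS. lra. }
  assert (DJ : forall x, Rabs x < e -> Derive J x = l (ui x)).
  { intros x Hx.
    pose proof (smooth1_is_derive _ _ _ OB SS Hx) as D1.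
    pose proof (smooth1_is_derive _ _ _ ON Sj (Sub _ (proj1 (HS x Hx)))) as D2.
    assert (D3 : is_derive J x (Derive ui x * Derive j (ui x)))
      by exact (is_derive_comp j ui x _ _ D2 D1).
    rewrite (is_derive_unique _ _ _ D3), Dj by now apply Sub, HS.
    transitivity (Derive u (ui x) * Derive ui x * l (ui x)); [ring|].
    rewrite DS by easy. ring. }
  assert (OJ : has_order (ball0 e) 0 (1 + k) J).
  { assert (OS : has_order (ball0 e) 0 1 (fun x => ui x - s0)).
    { assert (SS0 : smooth1 (ball0 e) (fun x => ui x - s0))
        by (apply (smooth_minus (V := R_NormedModule)); [easy|apply smooth_const]).
      apply order_of_derivatives; try easy.
      - intros x t Hx Ht. unfold ball0 in *.
        replace (0 + (x - 0) * t) with (x * t) by ring.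
        rewrite Rabs_mult, (Rabs_pos_eq t) by lra. pose proof (Rabs_pos x). nra.
      - intros i Hi. replace i with 0%nat by lia. simpl. rewrite S0. ring.
      - pose proof (smooth1_is_derive _ _ _ OB SS H0) as D1.
        replace (Derive_n (fun x => ui x - s0) 1 0) with (Derive ui 0); [now apply NS|].
        symmetry. apply is_derive_unique. auto_derive; [eexists; exact D1|].
        change (fun x => ui x) with ui. ring. }
    destruct OS as (w & Sw & Nw & Ew). destruct Oj as (chi & Schi & Nchi & Echi).
    exists (fun x => w x ^ (1 + k) * chi (ui x)). split; [|split].
    - apply (smooth_mult (V := R_NormedModule)); [now apply (smooth_pow (V := R_NormedModule))|].
      apply (smooth_comp (V := R_NormedModule) (ball0 e) (near s0 eta) chi ui); try easy.
      intros x Hx. now apply Sub, HS.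
    - rewrite S0. apply Rmult_integral_contrapositive_currified; [now apply pow_nonzero|easy].
    - intros x Hx. unfold J. rewrite Echi by now apply Sub, HS.
      rewrite Ew by easy. rewrite Rpow_mult_distr, pow_1. simpl. ring. }
  (* J''' has order k - 2 > 0, hence an isolated zero at 0. *)
  assert (O3 : has_order (ball0 e) 0 (k - 2) (Derive (Derive (Derive J)))).
  { do 3 (apply order_derive; [easy|]). now replace (S (S (S (k - 2)))) with (1 + k)%nat by lia. }
  destruct (order_sign _ _ _ OB H0 O3) as (e3 & cc & e3pos & _ & He3).
  set (e' := Rmin e e3).
  assert (e'pos : 0 < e') by now apply Rmin_pos.
  assert (e'l : e' <= e) by apply Rmin_l.
  assert (e'r : e' <= e3) by apply Rmin_r.
  assert (SubB : forall f, smooth1 (ball0 e) f -> smooth1 (ball0 e') f).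
  { intros f. apply (smooth_subset (V := R_NormedModule)). unfold ball0. intros; lra. }
  assert (Fac : forall s t, near s0 rr s -> Rabs (u s) < e' -> near s0 rr t -> Rabs (u t) < e' ->
     (s - t) ^ 4 * gt s t = (u s - u t) / ((1 + u s ^ 2) * (1 + u t ^ 2)) *
        trapezoid J (Derive J) (u s) (u t)).
  { intros s t Hs Hus Ht Hut. rewrite <- Egt by now apply Hin, Sub.
    rewrite Epre by now apply Sub. unfold trapezoid, J.
    fold J. rewrite !DJ by lra. rewrite !US by (easy || lra). easy. }
  assert (Bp : forall y, 1 + y ^ 2 <> 0) by (intros y; pose proof (pow2_ge_0 y); lra).
  assert (Nust : forall s t, near s0 rr s -> Rabs (u s) < e' -> near s0 rr t -> Rabs (u t) < e' ->
     s <> t -> u s <> u t).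
  { intros s t Hs Hus Ht Hut N E. apply N. rewrite <- (US s), <- (US t), E by (easy || lra). easy. }
  assert (Cu : forall s, near s0 rr s -> continuous u s).
  { intros s Hs. apply (smooth_continuous (V := R_NormedModule) (near s0 eta)); [easy|now apply Sub]. }
  exists rr, e', u, ui, J.
  split; [lra|]. split; [easy|]. split; [easy|]. split; [now apply SubB|]. split; [now apply SubB|].
  split; [|split; [|split; [|split; [|split]]]].
  - destruct OJ as (chi & Schi & Nchi & Echi). exists chi. split; [now apply SubB|split; [easy|]].
    intros x Hx. apply Echi. unfold ball0 in *. lra.
  - intros s Hs. split; [now apply Hin, Sub|now apply Cu].
  - intros x Hx. split; [|split]; [apply HS; lra|apply HS; lra|apply NS; lra].
  - intros s Hs Hus. apply US; [easy|lra].
  - intros s t Hs Hus Ht Hut N.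
    pose proof (Fac s t Hs Hus Ht Hut) as E. pose proof (Nust s t Hs Hus Ht Hut N) as Nu'.
    assert (N1 : (s - t) ^ 4 <> 0) by (apply pow_nonzero; lra).
    assert (N2 : (u s - u t) / ((1 + u s ^ 2) * (1 + u t ^ 2)) <> 0).
    { apply Rmult_integral_contrapositive_currified; [lra|].
      apply Rinv_neq_0_compat, Rmult_integral_contrapositive_currified; apply Bp. }
    split; intros Z; rewrite Z, Rmult_0_r in E.
    + symmetry in E. apply Rmult_integral in E. now destruct E.
    + apply Rmult_integral in E. now destruct E.
  - intros s Hs Hus.
    assert (Hue : Rabs (u s) < e) by lra.
    rewrite (diagonal_value (fun t => gt t s) u J e s (Derive u s)); try easy.
    + split; intros Z.
      * destruct (Req_dec (u s) 0) as [|N]; [easy|].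
        destruct (He3 (u s)) as [_ P]; [lra|]. specialize (P N). rewrite Z in P. lra.
      * rewrite Z. destruct O3 as (chi & _ & _ & E3). rewrite E3 by easy.
        rewrite Rminus_diag, pow_i by lia. ring.
    + apply (smooth1_is_derive (near s0 eta)); try easy. now apply Sub.
    + intros E. pose proof (DS (u s) Hue) as E1. rewrite US, E in E1 by easy. lra.
    + assert (C2 : continuity_2d_pt gt s s).
      { now apply (Sgt 0%nat s s); apply Hin, Sub. }
      apply continuity_2d_pt_filterlim in C2.
      apply (continuous_comp_2 (fun t => t) (fun _ => s) gt s);
        [apply continuous_id|apply continuous_const|exact C2].
    + assert (F : locally s (fun t => near s0 rr t /\ Rabs (u t) < e')).
      { apply filter_and; [now apply open_near|]. apply (Cu s Hs (ball0 e')).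
        now apply open_ball0. }
      apply filter_imp with (2 := F). intros t [Ht Hut] N. split.
      * now apply Nust.
      * now apply Fac.
Qed.

Lemma open_pair_near s0 rr (u : R -> R) (P : R -> R -> Prop) :
  (forall s, near s0 rr s -> continuous u s) ->
  open (T := R2) (fun z => P (fst z) (snd z)) ->
  open (T := prod_UniformSpace R_UniformSpace R_UniformSpace)
    (fun q : R * R => near s0 rr (fst q) /\ near s0 rr (snd q) /\ P (u (fst q)) (u (snd q))).
Proof.
  intros Cu OP [s t] (Hs & Ht & HP). simpl in *.
  assert (Cf : continuous (T := prod_UniformSpace R_UniformSpace R_UniformSpace) (U := R_UniformSpace)
      fst (s, t)) by apply (continuous_fst (U := R_UniformSpace) (V := R_UniformSpace)).
  assert (Cs : continuous (T := prod_UniformSpace R_UniformSpace R_UniformSpace) (U := R_UniformSpace)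
      snd (s, t)) by apply (continuous_snd (U := R_UniformSpace) (V := R_UniformSpace)).
  apply filter_and; [|apply filter_and].
  - apply (Cf (near s0 rr)). now apply open_near.
  - apply (Cs (near s0 rr)). now apply open_near.
  - assert (C : continuous (T := prod_UniformSpace R_UniformSpace R_UniformSpace) (U := R2)
        (fun q => (u (fst q), u (snd q))) (s, t)).
    { apply (continuous_comp_2 (X := R2) (fun q => u (fst q)) (fun q => u (snd q)) (fun x y => (x, y)) (s, t)).
      - apply (continuous_comp fst u); [exact Cf|now apply Cu].
      - apply (continuous_comp snd u); [exact Cs|now apply Cu].
      - apply (continuous_ext (fun x => x)); [now intros []|apply continuous_id]. }
    apply (C (fun z => P (fst z) (snd z))). now apply OP.
Qed.

Theorem mainTheorem1
    (a b : Rbar) (gamma : R -> R * R) (gt : R -> R -> R)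
    (k : nat) (s0 : R) (c : R * R) (r : R)
    (hgamma : smooth_regular a b gamma)
    (hgt : presym_quotient a b gamma gt)
    (hs0 : in_itv a b s0)
    (hk : (3 <= k)%nat)
    (hcontact : has_A_contact gamma c r k s0) :
  (Nat.Odd k -> single_transverse_branch (presym_set a b gt) (s0, s0)) /\
  (Nat.Even k -> isolated_point (presym_set a b gt) (s0, s0)).
Proof.
  destruct (local_model a b gamma gt k s0 c r hgamma hgt hs0 hk hcontact)
    as (rr & e1 & u & ui & J & rpos & e1pos & u0 & SS & SJ & OJ & Near & HS & US & Off & Diag).
  assert (Cu : forall s, near s0 rr s -> continuous u s) by (intros; now apply Near).
  assert (N0 : near s0 rr s0) by now apply near_center.
  assert (U0 : Rabs (u s0) < e1) by now rewrite u0, Rabs_R0.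
  assert (S0 : ui 0 = s0) by (rewrite <- u0; now apply US).
  assert (Eq0 : forall s, near s0 rr s -> u s = 0 -> s = s0).
  { intros s Hs E. rewrite <- (US s), E by (easy || rewrite E, Rabs_R0; lra). exact S0. }
  split; intros Hpar.
  - destruct Hpar as [m Hm].
    replace (1 + k)%nat with (2 * (m - 1) + 4)%nat in OJ by lia.
    destruct (trapezoid_branch e1 J (m - 1) e1pos SJ OJ)
      as (eps & e & p & epos & Hee & Heps & Sp & p0 & Dp0 & Zp & Up).
    (* The parameter of the arc is half the difference of the u-coordinates, which
       is continuous on the plane and so inverts the arc. *)
    set (beta := fun d => (ui (p d + d), ui (p d - d))).
    assert (Bd : forall x d, Rabs x < eps -> Rabs d < e -> Rabs (x + d) < e1 /\ Rabs (x - d) < e1).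
    { intros x d Hx Hd. apply Rabs_def2 in Hx, Hd. split; apply Rabs_def1; lra. }
    assert (Bp : forall d, Rabs d < e -> Rabs (p d + d) < e1 /\ Rabs (p d - d) < e1).
    { intros d Hd. apply Bd; [now apply Zp|easy]. }
    assert (ub : forall d, Rabs d < e -> u (fst (beta d)) = p d + d /\ u (snd (beta d)) = p d - d).
    { intros d Hd. split; simpl; now apply HS, Bp. }
    pose proof (open_ball0 e) as OB. pose proof (open_ball0 e1) as OB1.
    assert (Dbeta : forall d, Rabs d < e -> velocity beta d =
      (Derive ui (p d + d) * (Derive p d + 1), Derive ui (p d - d) * (Derive p d - 1))).
    { intros d Hd. destruct (Bp d Hd) as [B1 B2].
      pose proof (smooth1_is_derive _ _ _ OB Sp Hd) as D1.
      pose proof (smooth1_is_derive _ _ _ OB1 SS B1) as D2.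
      pose proof (smooth1_is_derive _ _ _ OB1 SS B2) as D3.
      unfold velocity; simpl. f_equal; apply is_derive_unique.
      - auto_derive; [split; [eexists; exact D2|split; [eexists; exact D1|easy]]|].
        change (fun x => p x) with p. change (fun x => ui x) with ui. ring.
      - unfold Rminus in *.
        auto_derive; [split; [eexists; exact D3|split; [eexists; exact D1|easy]]|].
        change (fun x => p x) with p. change (fun x => ui x) with ui. ring. }
    assert (Itv : forall x, (- e < x < e) <-> Rabs x < e).
    { intros x; split; [intros; now apply Rabs_def1|intros H; apply Rabs_def2 in H; lra]. }
    assert (ItvR : forall x, in_itv (- e) e x <-> Rabs x < e).
    { intros x. rewrite <- Itv. unfold in_itv; simpl. easy. }
    assert (SB : forall sg, sg = 1 \/ sg = -1 -> smooth1 (ball0 e) (fun d => ui (p d + sg * d))).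
    { intros sg Hsg. apply (smooth_comp (V := R_NormedModule) (ball0 e) (ball0 e1) ui); [|easy|].
      - intros d Hd. destruct (Bp d Hd). destruct Hsg as [->| ->]; unfold ball0.
        + now replace (p d + 1 * d) with (p d + d) by ring.
        + now replace (p d + -1 * d) with (p d - d) by ring.
      - apply (smooth_plus (V := R_NormedModule)); [easy|].
        apply (smooth_mult (V := R_NormedModule)); [apply smooth_const|apply smooth1_id]. }
    exists (fun q => near s0 rr (fst q) /\ near s0 rr (snd q) /\
       Rabs ((u (fst q) + u (snd q)) / 2) < eps /\ Rabs ((u (fst q) - u (snd q)) / 2) < e), e, beta.
    split; [|split; [|split; [|split; [|split; [|split]]]]].
    + apply (open_pair_near s0 rr u (fun x y => Rabs ((x + y) / 2) < eps /\ Rabs ((x - y) / 2) < e)); [easy|].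
      apply (open_and (T := R2)).
      * apply (open_comp (T := R2) (U := R_UniformSpace) (fun z => (fst z + snd z) / 2) (ball0 eps));
          [|apply open_ball0].
        intros z _. apply (smooth2_continuous (fun _ => True)); [|easy].
        apply (smooth_mult (V := R2)); [|apply smooth_const].
        apply (smooth_plus (V := R2)); apply (smooth_linear (V := R2)); [apply is_linear_fst|apply is_linear_snd].
      * apply (open_comp (T := R2) (U := R_UniformSpace) (fun z => (fst z - snd z) / 2) (ball0 e));
          [|apply open_ball0].
        intros z _. apply (smooth2_continuous (fun _ => True)); [|easy].
        apply (smooth_mult (V := R2)); [|apply smooth_const].
        apply (smooth_minus (V := R2)); apply (smooth_linear (V := R2)); [apply is_linear_fst|apply is_linear_snd].
    + simpl. rewrite u0. repeat split; try easy.
      * replace ((0 + 0) / 2) with 0 by field. rewrite Rabs_R0. lra.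
      * replace ((0 - 0) / 2) with 0 by field. now rewrite Rabs_R0.
    + exact epos.
    + split; [split; [|split]|].
      * apply smooth_on_iff. apply (smooth_subset (V := R_NormedModule) (ball0 e)); [apply ItvR|].
        apply (smooth_ext (V := R_NormedModule)) with (fun d => ui (p d + 1 * d)); [easy| |apply SB; now left].
        intros d _. simpl. f_equal. ring.
      * apply smooth_on_iff. apply (smooth_subset (V := R_NormedModule) (ball0 e)); [apply ItvR|].
        apply (smooth_ext (V := R_NormedModule)) with (fun d => ui (p d + -1 * d)); [easy| |apply SB; now right].
        intros d _. simpl. f_equal. ring.
      * intros d Hd. apply ItvR in Hd. rewrite Dbeta by easy. destruct (Bp d Hd) as [B1 B2].
        intros E. injection E as E1 E2.
        apply Rmult_integral in E1, E2.
        destruct E1 as [E1|E1]; [now apply HS in E1|].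
        destruct E2 as [E2|E2]; [now apply HS in E2|]. lra.
      * exists (fun q => (u (fst q) - u (snd q)) / 2). intros d Hd. apply Itv in Hd.
        destruct (ub d Hd) as [E1 E2]. destruct (Bp d Hd) as [B1 B2].
        assert (Er : (u (fst (beta d)) - u (snd (beta d))) / 2 = d) by (rewrite E1, E2; field).
        split; [exact Er|].
        assert (C : continuous (T := prod_UniformSpace R_UniformSpace R_UniformSpace) (U := R_UniformSpace)
                      (fun q : R * R => (u (fst q) - u (snd q)) / 2) (beta d)).
        { apply (continuous_mult (U := prod_UniformSpace R_UniformSpace R_UniformSpace) (K := R_AbsRing)
                   (fun q => u (fst q) - u (snd q)) (fun _ => / 2)); [|apply continuous_const].
          apply (continuous_minus (U := prod_UniformSpace R_UniformSpace R_UniformSpace) (V := R_NormedModule)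
                   (fun q => u (fst q)) (fun q => u (snd q))).
          - apply (continuous_comp fst u); [apply continuous_fst|]. now apply Cu, HS.
          - apply (continuous_comp snd u); [apply continuous_snd|]. now apply Cu, HS. }
        intros P HP. rewrite <- Er in HP.
        destruct (C P HP) as [del Hdel]. exists del. intros q Hq _. now apply Hdel.
    + unfold beta. rewrite p0. now rewrite Rplus_0_l, Rminus_0_r, S0.
    + intros [s t]. simpl. split.
      * intros [(Hs & Ht & Hp & Hd) (_ & _ & Z)]. simpl in Z.
        set (x := (u s + u t) / 2) in *. set (d := (u s - u t) / 2) in *.
        assert (Es : u s = x + d) by (unfold x, d; field).
        assert (Et : u t = x - d) by (unfold x, d; field).
        destruct (Bd x d Hp Hd) as [B1 B2].
        assert (Us : Rabs (u s) < e1) by now rewrite Es.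
        assert (Ut : Rabs (u t) < e1) by now rewrite Et.
        exists d. split; [now apply Itv|].
        destruct (Req_dec s t) as [<-|N].
        -- apply Diag in Z; try easy. assert (d = 0) as -> by (unfold d; field).
           unfold beta. rewrite p0, Rplus_0_l, Rminus_0_r, S0.
           now rewrite (Eq0 s Hs Z).
        -- apply Off in Z; try easy. rewrite Es, Et in Z.
           assert (Nd : d <> 0).
           { intros E. apply N. rewrite <- (US s), <- (US t), Es, Et, E by easy. f_equal. ring. }
           apply Up in Z; try easy. unfold beta. rewrite <- Z, <- Es, <- Et, !US by easy. easy.
      * intros (d & Hd & Eb). apply Itv in Hd. destruct (ub d Hd) as [E1 E2].
        destruct (Bp d Hd) as [B1 B2]. destruct (Zp d Hd) as [Hp Z].
        rewrite Eb in E1, E2. simpl in E1, E2.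
        assert (Ns : near s0 rr s /\ near s0 rr t).
        { unfold beta in Eb. injection Eb as <- <-. split; now apply HS. }
        destruct Ns as [Ns Nt].
        split; [split; [easy|split; [easy|split]]|split; [|split]]; simpl.
        -- rewrite E1, E2. replace ((p d + d + (p d - d)) / 2) with (p d) by field. easy.
        -- rewrite E1, E2. replace ((p d + d - (p d - d)) / 2) with d by field. easy.
        -- now apply Near.
        -- now apply Near.
        -- destruct (Req_dec s t) as [<-|N].
           ++ apply Diag; [easy|now rewrite E1|].
              assert (d = 0) by lra. rewrite E1. subst d. rewrite p0. ring.
           ++ apply Off; try easy; [now rewrite E1|now rewrite E2|]. now rewrite E1, E2.
    + intros d Hd E. apply Itv in Hd. destruct (ub d Hd) as [E1 E2].
      rewrite E in E1. assert (d = 0) by lra. subst d.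
      rewrite Dbeta by easy. simpl. rewrite p0, (is_derive_unique _ _ _ Dp0).
      assert (H0 : Rabs 0 < e1) by (rewrite Rabs_R0; lra).
      destruct (HS 0 H0) as (_ & _ & NS).
      replace (0 + 0) with 0 by ring. replace (0 - 0) with 0 by ring. lra.
  - destruct Hpar as [m Hm].
    replace (1 + k)%nat with (2 * (m - 1) + 3)%nat in OJ by lia.
    destruct (trapezoid_isolated e1 J (m - 1) e1pos SJ OJ) as (e & He & Iso).
    split.
    + split; [easy|split; [easy|]]. simpl. now apply Diag.
    + exists (fun q => near s0 rr (fst q) /\ near s0 rr (snd q) /\ Rabs (u (fst q)) < e /\ Rabs (u (snd q)) < e).
      split; [|split].
      * apply (open_pair_near s0 rr u (fun x y => Rabs x < e /\ Rabs y < e)); [easy|].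
        apply (open_and (T := R2)).
        -- apply (open_comp (T := R2) (U := R_UniformSpace) fst (ball0 e)); [|apply open_ball0].
           intros [] _; apply (continuous_fst (U := R_UniformSpace) (V := R_UniformSpace)).
        -- apply (open_comp (T := R2) (U := R_UniformSpace) snd (ball0 e)); [|apply open_ball0].
           intros [] _; apply (continuous_snd (U := R_UniformSpace) (V := R_UniformSpace)).
      * simpl. rewrite u0, Rabs_R0. repeat split; easy.
      * intros [s t] (Hs & Ht & Hus & Hut) (_ & _ & Z). simpl in *.
        destruct (Req_dec s t) as [<-|N].
        -- apply Diag in Z; [|easy|lra]. now rewrite (Eq0 s Hs Z).
        -- apply Off in Z; try easy; try lra. exfalso. revert Z. apply Iso; try easy.
           intros E. apply N. rewrite <- (US s), <- (US t), E by (easy || lra). easy.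
Qed.
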